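(* For non-negative integers $x$, $y$, $z$ and $k$ of the same parity, with $k\leq x,y,z$, \[ \operatorname{M}_{\odot}(B_{x,y,z,k})=P\left(\tfrac{y+k}{2},\tfrac{z-k}{2},k\right) \prod_{i=1}^{(y-k)/2}\frac{\left(\frac{x-k}{2}+i\right)_k}{(i)_k} \prod_{i=1}^{(z-k)/2}\frac{\left(\frac{x+k}{2}+i\right)_{(y-k)/2}}{(k+i)_{(y-k)/2}} \frac{\left(\frac{x+k}{2}+i\right)_{(y+k)/2}}{(k+i)_{(y+k)/2}}. \]
   Context: $P(x,y,z)=\prod_{i=1}^x\prod_{j=1}^y\prod_{k=1}^z \frac{i+j+k-1}{i+j+k-2}$ (MacMahon's count of lozenge tilings of the hexagon with sides $x,y,z,x,y,z$), and $(a)_k$ is the Pochhammer symbol (rising factorial). $B_{x,y,z,k}$ is the region obtained from the hexagon $H_{x,y,z}$ of side-lengths $x,y,z,x,y,z$ (in cyclic order) on the triangular lattice by removing from its center a bowtie with lobes of size $k$ (two equilateral triangles of side $k$ touching at the center), whose edges not touching the center are parallel to the sides of length $z$. $\operatorname{M}_{\odot}(R)$ denotes the number of centrally symmetric lozenge tilings of the region $R$ (equivalently, centrally symmetric perfect matchings of its planar dual). *)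

(* Defs.v *)
From mathcomp Require Import all_boot all_order all_algebra.

Set Implicit Arguments.
Unset Strict Implicit.
Unset Printing Implicit Defensive.

Import GRing.Theory.

(* The triangular lattice is coordinatized by the unit vectors u (direction
   0 degrees) and v (direction 60 degrees): the pair (a, b) is the lattice point
   a u + b v.  The third lattice direction is w = v - u = (-1, 1).
   The parallelogram with corners (0, 0), (m, 0), (m, n), (0, n) is made of 2mn
   unit triangles: each unit rhombus (i, j), (i+1, j), (i+1, j+1), (i, j+1) is cut
   by the segment from (i+1, j) to (i, j+1) into an up-pointing triangle
   (i, j, false) and a down-pointing triangle (i, j, true). *)
Notation cell m n := ('I_m * 'I_n * bool)%type.

Definition vertices m n (c : cell m n) : seq (nat * nat) :=
  let: (i, j, down) := c in
  [:: if down then (i.+1, j.+1) else (val i, val j);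
      (i.+1, val j); (val i, j.+1)].

Definition adjacent m n (c d : cell m n) : bool :=
  count (mem (vertices d)) (vertices c) == 2.

Definition is_lozenge m n (L : {set cell m n}) : bool :=
  [exists c, exists d, adjacent c d && (L == [set c; d])].

Definition is_tiling m n (R : {set cell m n}) (P : {set {set cell m n}}) : bool :=
  partition P R && [forall L in P, is_lozenge L].

(* The rotation by 180 degrees about the center (m/2, n/2) of the
   parallelogram, as witnessed by vertices_half_turn. *)
Definition half_turn m n (c : cell m n) : cell m n :=
  let: (i, j, down) := c in (rev_ord i, rev_ord j, ~~ down).

Lemma vertices_half_turn m n (c : cell m n) :
  perm_eq (vertices (half_turn c))
          [seq (m - p.1, n - p.2) | p <- vertices c].
Proof.
by case: c => [[i j] []]; rewrite /= ?subnSK //;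
  rewrite perm_cons (perm_catC [:: _] [:: _]) perm_refl.
Qed.

Definition centrally_symmetric m n (P : {set {set cell m n}}) : bool :=
  [set @half_turn m n @: L | L : {set cell m n} in P] == P.

Definition M_odot m n (R : {set cell m n}) : nat :=
  #|[set P | is_tiling R P && centrally_symmetric P]|.

(* The hexagon with vertices (z, 0), (x+z, 0), (x+z, y), (x, y+z), (0, y+z),
   (0, z), whose successive sides are x u, y v, z w, - x u, - y v, - z w.  Its
   center ((x+z)/2, (y+z)/2) is that of its bounding parallelogram. *)
Definition in_hexagon (x y z : nat) (p : nat * nat) : bool :=
  [&& p.1 <= x + z, p.2 <= y + z & z <= p.1 + p.2 <= x + y + z].

Definition hexagon (x y z : nat) : {set cell (x + z) (y + z)} :=
  [set c | all (in_hexagon x y z) (vertices c)].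

(* The lobes are the triangles of vertices o, o + k u, o + k v and o, o - k u,
   o - k v; in both, the side opposite to o is parallel to w. *)
Definition in_upper_lobe (o : nat * nat) (k : nat) (p : nat * nat) : bool :=
  [&& o.1 <= p.1, o.2 <= p.2 & p.1 + p.2 <= o.1 + o.2 + k].

Definition in_lower_lobe (o : nat * nat) (k : nat) (p : nat * nat) : bool :=
  [&& p.1 <= o.1, p.2 <= o.2 & o.1 + o.2 <= p.1 + p.2 + k].

Definition bowtie m n (o : nat * nat) (k : nat) : {set cell m n} :=
  [set c | all (in_upper_lobe o k) (vertices c)
           || all (in_lower_lobe o k) (vertices c)].

(* The halves are exact, i.e. the center of the hexagon is a lattice point, when
   x, y and z have the same parity. *)
Definition B (x y z k : nat) : {set cell (x + z) (y + z)} :=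
  hexagon x y z :\: bowtie _ _ ((x + z)./2, (y + z)./2) k.

Local Open Scope ring_scope.

Definition pochhammer (a : rat) (k : nat) : rat := \prod_(i < k) (a + i%:R).

Definition macmahon (x y z : nat) : rat :=
  \prod_(1 <= i < x.+1) \prod_(1 <= j < y.+1) \prod_(1 <= k < z.+1)
    ((i + j + k - 1)%N%:R / (i + j + k - 2)%N%:R).

(* Main.v *)
(* A tiling is a family of x nonintersecting lattice paths running from the top
   side of the hexagon to its bottom side through the lozenges having horizontal
   sides, each step moving by 0 or 1.  A centrally symmetric tiling is determined
   by its upper half, i.e. by paths ending on the horizontal line through the
   center, and the set A of end points is subject to: A contains the top side of
   the lower lobe, avoids the bottom side of the upper lobe, and its remaining
   part is symmetric about the center.  So the number of tilings is the sum over
   such A of det (C(h, A_j - i)), with h = (y + z) / 2.  Each determinant is a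
   product of the Vandermonde product of A and of factorials.  Since A is
   symmetric but for k points, with a points on each side, its Vandermonde
   product is the square of the Vandermonde product of the quantities
   l (l + 2 k + 1), where o + k + l runs over the points of A on the right, times
   simple factors.  Hence (Andreief) the sum is an a x a Hankel determinant of
   moments of a discrete weight of dual Hahn type; factoring shifted weights out
   of the moments makes them summable in closed form (WZ), and what remains is
   the Hankel determinant of the numbers s! / (s + k + 1)!. *)
Require Import Defs.
From mathcomp Require Import all_boot all_order all_fingroup all_algebra.
From mathcomp Require Import zify ring.

Set Implicit Arguments.
Unset Strict Implicit.
Unset Printing Implicit Defensive.

Import GRing.Theory Num.Theory.

(** * Peeling centrally symmetric tilings *)

Ltac decide_nat_eq :=
  repeat match goal with |- context[?a == ?b] =>
    first [rewrite (_ : (a == b) = true); last by lia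
         | rewrite (_ : (a == b) = false); last by lia] end.

Lemma adjacentE m n (c d : cell m n) :
  adjacent c d = (c.2 != d.2) &&
    let: (up, down) := if c.2 then (d.1, c.1) else (c.1, d.1) in
    [|| (down.1 == up.1 :> nat) && (down.2 == up.2 :> nat),
        (down.1.+1 == up.1) && (down.2 == up.2 :> nat)
      | (down.1 == up.1 :> nat) && (down.2.+1 == up.2)].
Proof.
move: c d => [[i j] s] [[i' j'] s']; rewrite /adjacent /=.
(* Triangles whose coordinates differ by two or more share no vertex. Splitting each coordinate into
   five cases leaves only comparisons that [lia] decides. *)
have Hp : i' = i :> nat \/ i' = i.+1 :> nat \/ i = i'.+1 :> nat \/ i'.+1 < i \/ i.+1 < i' by lia.
have Hq : j' = j :> nat \/ j' = j.+1 :> nat \/ j = j'.+1 :> nat \/ j'.+1 < j \/ j.+1 < j' by lia.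
case: s s' => [] [];
  rewrite /= -![\val _]/(nat_of_ord _) !inE !xpair_eqE /=;
  move: (nat_of_ord i) (nat_of_ord j) (nat_of_ord i') (nat_of_ord j') Hp Hq => p q p' q';
  case=> [Hp|[Hp|[Hp|Hp]]]; case=> [Hq|[Hq|[Hq|Hq]]]; try subst p'; try subst q';
  try subst p; try subst q; decide_nat_eq; rewrite ?andbF ?andbT ?orbF ?orbT //=.
Qed.

Lemma adjacent_sym m n (c d : cell m n) : adjacent c d = adjacent d c.
Proof. by rewrite !adjacentE eq_sym; case: c.2 d.2 => [] []. Qed.

Lemma half_turnK m n : involutive (@half_turn m n).
Proof. by move=> [[i j] s]; rewrite /half_turn !rev_ordK negbK. Qed.

Lemma adjacent_half_turn m n (c d : cell m n) :
  adjacent (half_turn c) (half_turn d) = adjacent c d.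
Proof.
move: c d => [[i j] s] [[i' j'] s']; rewrite !adjacentE /=.
have := (ltn_ord i, ltn_ord i', ltn_ord j, ltn_ord j') => -[[[? ?] ?] ?].
case: s s' => [] []; rewrite //=; lia.
Qed.

Notation tilings R :=
  [set P | is_tiling R P && centrally_symmetric P].

Lemma half_turn_inj m n : injective (@half_turn m n).
Proof. exact: can_inj (@half_turnK m n). Qed.

Lemma tilingP m n (R : {set cell m n}) P :
  reflect [/\ cover P = R, trivIset P & {in P, forall L, is_lozenge L}]
          (is_tiling R P).
Proof.
apply: (iffP andP) => [[/and3P[/eqP cP tP _] /forall_inP lP]|[cP tP lP]].
  by split.
split; last exact/forall_inP.
rewrite /partition cP eqxx tP /=; apply/negP => /lP /existsP[c /existsP[d]].
by case/andP=> _ /eqP /setP /(_ c); rewrite !inE eqxx.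
Qed.

Lemma symmetricP m n (P : {set {set cell m n}}) :
  reflect (forall L, L \in P -> @half_turn m n @: L \in P)
          (centrally_symmetric P).
Proof.
have hK (L : {set cell m n}) : @half_turn m n @: (@half_turn m n @: L) = L.
  by rewrite -imset_comp (eq_imset _ (@half_turnK m n)) imset_id.
apply: (iffP eqP) => [eP L LP|H].
  by rewrite -eP; apply: imset_f.
apply/setP => L; apply/imsetP/idP => [[K /H KP ->] //|LP].
by exists (@half_turn m n @: L); [exact: H | rewrite hK].
Qed.

Lemma imset_set2 (aT rT : finType) (f : aT -> rT) c d :
  f @: [set c; d] = [set f c; f d].
Proof. by rewrite imsetU1 imset_set1. Qed.

Section Peel.
Variables (m n : nat).
Hypothesis no_self : forall c : cell m n, ~~ adjacent c (half_turn c).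
Implicit Types (c d : cell m n) (R : {set cell m n}) (P : {set {set cell m n}}).

(** Symmetric tilings are peeled two lozenges at a time, a lozenge with its image, so that what is
    left stays symmetric. *)
Definition pair4 c d : {set cell m n} :=
  [set c; d] :|: [set half_turn c; half_turn d].

(** The half turn exchanges the two orientations, so [c] is not its own image. If [c] were the image
    of [d], it would be adjacent to its own image, against [no_self]. *)
Lemma disjoint_pair4 c d : adjacent c d -> 
  [disjoint [set c; d] & [set half_turn c; half_turn d]].
Proof.
move=> cd; rewrite -setI_eq0; apply/eqP/setP => e; rewrite !inE.
apply/negP => /andP[/pred2P[]-> /pred2P[]] E.
- by move: c E {cd} => [[i j] []].
- by have := no_self c; rewrite {2}E half_turnK cd.
- by have := no_self c; rewrite -E cd.
- by move: d E {cd} => [[i j] []].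
Qed.

Lemma lozenge_through R P c : is_tiling R P -> c \in R ->
  exists2 d, (d \in R) && adjacent c d & [set c; d] \in P.
Proof.
case/tilingP=> cP tP lP; rewrite -cP => /bigcupP[L LP cL].
have /existsP[c' /existsP[d' /andP[ad /eqP eL]]] := lP _ LP.
have sub e : e \in L -> e \in cover P by move=> eL'; apply/bigcupP; exists L.
move: cL; rewrite eL => /set2P[] E.
  exists d'; last by rewrite E -eL.
  by rewrite E ad sub // eL set22.
exists c'; first by rewrite E adjacent_sym ad sub // eL set21.
by rewrite E setUC -eL.
Qed.

Lemma trivIset_eq P L K c : trivIset P -> L \in P -> K \in P ->
  c \in L -> c \in K -> L = K.
Proof.
move=> /trivIsetP tP LP KP cL cK; apply/eqP/negPn/negP => /(tP _ _ LP KP).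
by rewrite -setI_eq0 => /eqP/setP/(_ c); rewrite !inE cL cK.
Qed.

Lemma set2_inj (T : finType) (c d e : T) : c != e -> [set c; d] = [set c; e] -> d = e.
Proof.
move=> ce /setP/(_ e); rewrite !inE eqxx orbT => /orP[]/eqP // E.
by rewrite E eqxx in ce.
Qed.

Lemma adjacent_neq (c d : cell m n) : adjacent c d -> c != d.
Proof. by rewrite adjacentE => /andP[ne _]; apply: contraNneq ne => ->. Qed.

(** Deleting the lozenge and its image is a bijection, whose inverse adds them back. Symmetry of the
    tiling puts the image in it as soon as the lozenge is. *)
Lemma card_tilings_with R c d :
  (@half_turn m n) @: R = R -> c \in R -> d \in R -> adjacent c d ->
  #|[set P in tilings R | [set c; d] \in P]| = #|tilings (R :\: pair4 c d)|.
Proof.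
move=> sR cR dR ad.
pose L := [set c; d]; pose L' := [set half_turn c; half_turn d].
have eL' : @half_turn m n @: L = L' by rewrite imset_set2.
have eL : @half_turn m n @: L' = L by rewrite imset_set2 !half_turnK.
have hR e : e \in R -> half_turn e \in R by move=> eR; rewrite -sR imset_f.
have dLL' : [disjoint L & L'] := disjoint_pair4 ad.
have zL : is_lozenge L by apply/existsP; exists c; apply/existsP; exists d; rewrite ad eqxx.
have zL' : is_lozenge L'.
  by apply/existsP; exists (half_turn c); apply/existsP; exists (half_turn d);
     rewrite adjacent_half_turn ad eqxx.
pose del P := P :\: [set L; L'].
rewrite -(@card_in_imset _ _ del); last first.
  move=> P Q; rewrite !inE => /andP[/andP[_ /symmetricP sP] LP].
  move=> /andP[/andP[_ /symmetricP sQ] LQ] E.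
  have LP' : L' \in P by rewrite -eL'; apply: sP.
  have LQ' : L' \in Q by rewrite -eL'; apply: sQ.
  have subP : [set L; L'] \subset P by apply/subsetP => K /set2P[]->.
  have subQ : [set L; L'] \subset Q by apply/subsetP => K /set2P[]->.
  rewrite -(setID P [set L; L']) -(setID Q [set L; L']).
  by rewrite (setIidPr subP) (setIidPr subQ) -/(del P) E.
apply: eq_card => Q; apply/imsetP/idP => [[P]|].
  rewrite !inE => /andP[/andP[tP /symmetricP sP] LP] ->{Q}.
  have /tilingP[cP trP lP] := tP.
  have LP' : L' \in P by rewrite -eL'; apply: sP.
  apply/andP; split; last first.
    apply/symmetricP => K; rewrite !inE => /andP[/norP[KL KL'] KP].
    rewrite sP // andbT; apply/norP; split.
    - apply: contraNneq KL' => KE; rewrite -eL' -KE -imset_comp.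
      by rewrite (eq_imset _ (@half_turnK m n)) imset_id.
    - apply: contraNneq KL => KE; rewrite -eL -KE -imset_comp.
      by rewrite (eq_imset _ (@half_turnK m n)) imset_id.
  apply/tilingP; split.
  - apply/setP => e; apply/bigcupP/idP => [[K]|].
      rewrite !inE => /andP[/norP[KL KL'] KP] eK.
      rewrite -cP; apply/andP; split; last by apply/bigcupP; exists K.
      rewrite -in_set2 -[X in _ || X]in_set2; apply/negP => /orP[] eL1.
      + by move: KL; rewrite (trivIset_eq trP KP LP eK eL1) eqxx.
      + by move: KL'; rewrite (trivIset_eq trP KP LP' eK eL1) eqxx.
    rewrite in_setD => /andP[]; rewrite in_setU => /norP[eL1 eL2].
    rewrite -cP => /bigcupP[K KP eK]; exists K => //; rewrite !inE KP andbT.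
    by apply/norP; split; [apply: contraNneq eL1|apply: contraNneq eL2] => KE; rewrite -?/L -?/L' -KE.
  - by apply: trivIsetS trP; apply: subsetDl.
  - by move=> K; rewrite inE => /andP[_ /lP].
rewrite inE => /andP[/tilingP[cQ trQ lQ] /symmetricP sQ].
have nL K e : K \in Q -> e \in K -> (e \notin L) && (e \notin L').
  move=> KQ eK; have : e \in cover Q by apply/bigcupP; exists K.
  by rewrite cQ !inE => /andP[]; rewrite !negb_or => /andP[/andP[-> ->] /andP[-> ->]].
have LQ : L \notin Q by apply/negP => /nL/(_ (set21 c d)); rewrite set21.
have LQ' : L' \notin Q.
  by apply/negP => /nL/(_ (set21 _ _)); rewrite set21 andbF.
exists ([set L; L'] :|: Q); last first.
  rewrite /del setDUl setDv set0U; apply/esym/setDidPl.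
  rewrite -setI_eq0; apply/eqP/setP => K; rewrite !inE.
  by apply/negP => /andP[KQ /pred2P[] E]; move: KQ; rewrite E ?(negPf LQ) ?(negPf LQ').
have mem K : K \in [set L; L'] :|: Q -> [\/ K = L, K = L' | K \in Q].
  by rewrite !inE => /orP[/orP[]/eqP|] ->; constructor.
rewrite !inE eqxx /= andbT; apply/andP; split; last first.
  apply/symmetricP => K /mem[->|->|KQ]; rewrite ?eL ?eL' !inE ?eqxx ?orbT //.
  by rewrite sQ ?orbT.
apply/tilingP; split.
- rewrite /cover bigcup_setU bigcup_setU !big_set1 -/(cover Q) cQ.
  rewrite setDE setUIr setUCr setIT; apply/setUidPr/subsetP => e.
  by rewrite !inE => /orP[]/pred2P[]->; rewrite ?hR.
- apply/trivIsetP => K1 K2 /mem M1 /mem M2.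
  have dQ K : K \in Q -> [disjoint L & K] && [disjoint L' & K].
    move=> KQ; rewrite -!setI_eq0; apply/andP.
    by split; apply/eqP/setP => e; rewrite in_setI in_set0; apply/negP => /andP[e1];
      move=> /(nL _ _ KQ); rewrite e1 ?andbF.
  case: M1 M2 => [->|->|K1Q] [->|->|K2Q]; rewrite ?eqxx // => ne.
  + by case/andP: (dQ _ K2Q).
  + by rewrite disjoint_sym.
  + by case/andP: (dQ _ K2Q).
  + by rewrite disjoint_sym; case/andP: (dQ _ K1Q).
  + by rewrite disjoint_sym; case/andP: (dQ _ K1Q).
  + exact: (trivIsetP trQ).
- by move=> K /mem[->|->|/lQ].
Qed.

(** Tilings are classified by the partner of [c], which is unique because the lozenges of a tiling
    are disjoint. *)
Lemma card_tilings_peel R c :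
  (@half_turn m n) @: R = R -> c \in R ->
  #|tilings R| = \sum_(d in R | adjacent c d) #|tilings (R :\: pair4 c d)|.
Proof.
move=> sR cR; rewrite -sum1_card.
transitivity (\sum_(P in tilings R)
    \sum_(d | (d \in R) && adjacent c d) ([set c; d] \in P : nat)).
  apply: eq_bigr => P; rewrite inE => /andP[tP _].
  have [d dR LP] := lozenge_through tP cR.
  rewrite (bigD1 d) //= LP big1 ?addn0 // => e /andP[/andP[eR ce] ed].
  case E: ([set c; e] \in P) => //.
  have /tilingP[_ trP _] := tP.
  have /set2_inj := trivIset_eq trP E LP (set21 c e) (set21 c d).
  case/andP: dR => _ /adjacent_neq cd /(_ cd) ede.
  by rewrite ede eqxx in ed.
rewrite exchange_big /=; apply: eq_bigr => d /andP[dR cd].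
rewrite -card_tilings_with // -sum1_card [RHS]big_mkcond [LHS]big_mkcond /=.
by apply: eq_bigr => P _; rewrite !inE; case: (_ && centrally_symmetric P); case: (_ \in P).
Qed.

Lemma card_tilings0 : #|tilings (set0 : {set cell m n})| = 1.
Proof.
apply/eqP/cards1P; exists set0; apply/setP => P; rewrite !inE /is_tiling partition_set0.
apply/idP/eqP => [/andP[/andP[/eqP-> //]]|->]; rewrite eqxx /=.
by apply/andP; split; [apply/forall_inP => L; rewrite inE | apply/symmetricP => L; rewrite inE].
Qed.

End Peel.

Section Forced.
Variables (m n : nat).
Hypothesis no_self : forall c : cell m n, ~~ adjacent c (half_turn c).
Implicit Types (c d : cell m n) (R X : {set cell m n}).

(** Each triangle of [X] has a single possible partner, so [card_tilings_peel] has one term;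
    induction on the size of [X]. *)
Lemma card_tilings_forced R X (phi : cell m n -> cell m n) :
    (@half_turn m n) @: R = R ->
    {in X, forall c, [/\ c \in R, ~~ c.2, phi c \in R, adjacent c (phi c)
                       & forall d, d \in R -> adjacent c d -> d = phi c]} ->
    {in X &, injective phi} ->
  #|tilings R| = #|tilings (R :\: \bigcup_(c in X) pair4 c (phi c))|.
Proof.
have [N] := ubnP #|X|; elim: N R X => // N IH R X ltXN sR HX injX.
have [->|[c cX]] := set_0Vmem X; first by rewrite big_set0 setD0.
have hR e : e \in R -> half_turn e \in R by move=> eR; rewrite -sR imset_f.
have par c' d' : adjacent c' d' -> c'.2 = ~~ d'.2.
  by rewrite adjacentE => /andP[]; case: c'.2 d'.2 => [] [].
have par_h c' : (half_turn c').2 = ~~ c'.2 by case: c' => [[]].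
have [cR c2 pR cp uc] := HX _ cX.
rewrite (card_tilings_peel no_self sR cR).
rewrite (big_pred1 (phi c)); last first.
  move=> d; apply/andP/eqP => [[dR cd]|->]; [exact: uc | by []].
(* [X] may also contain the half turn of [phi c], as happens on the central line. Its forced lozenge
   is the image of that of [c] and disappears at the same time. *)
pose X1 := X :\: [set c; half_turn (phi c)].
have E y : y \in X -> y = half_turn (phi c) -> phi y = half_turn c.
  move=> yX yE; have [_ _ _ _ uy] := HX _ yX; apply/esym/uy; first exact: hR.
  by rewrite yE adjacent_half_turn adjacent_sym.
rewrite (IH _ X1); last 4 first.
- rewrite -ltnS; apply: leq_trans ltXN; rewrite ltnS; apply/proper_card/properP; split.
    exact: subsetDl.
  by exists c; rewrite // !inE eqxx.
- apply/setP => e; apply/imsetP/idP => [[d + ->]|].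
    rewrite !inE !negb_or => /andP[/andP[/andP[d1 d2] /andP[d3 d4]] dR].
    rewrite !(inj_eq (@half_turn_inj m n)) !(inv_eq (@half_turnK m n)) hR //.
    by rewrite d1 d2 d3 d4.
  rewrite !inE !negb_or => /andP[/andP[/andP[d1 d2] /andP[d3 d4]] dR].
  exists (half_turn e); rewrite ?half_turnK // !inE !negb_or hR //.
  by rewrite !(inj_eq (@half_turn_inj m n)) !(inv_eq (@half_turnK m n)) d1 d2 d3 d4.
- move=> y; rewrite !inE negb_or => /andP[/andP[yc yp] yX].
  have [yR y2 pyR yp' uy] := HX _ yX.
  have p2 := par _ _ cp; have py2 := par _ _ yp'.
  have ne (u v : cell m n) : u.2 != v.2 -> u != v by apply: contraNneq => ->.
  split=> //; last by move=> d; rewrite inE => /andP[_ dR]; apply: uy.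
  + rewrite !negb_or yc yp yR !ne ?par_h //; by move: c2 y2 p2; case: c.2 y.2 (phi c).2 => [] [] [].
  + rewrite !negb_or pyR andbT (ne (phi y) c) ?(ne (phi y) (half_turn (phi c))) ?par_h /=; last 2 first.
    * by move: c2 y2 p2 py2; case: c.2 y.2 (phi c).2 (phi y).2 => [] [] [] [].
    * by move: c2 y2 p2 py2; case: c.2 y.2 (phi c).2 (phi y).2 => [] [] [] [].
    rewrite andbT; apply/andP; split.
      by apply: contraNneq yc => /injX ->.
    apply: contraNneq yp => pE; rewrite eq_sym (inv_eq (@half_turnK m n)) eq_sym.
    apply/eqP/uc; first exact: hR.
    by rewrite -(half_turnK c) adjacent_half_turn -pE adjacent_sym.
- by move=> u v; rewrite !inE => /andP[_ uX] /andP[_ vX]; apply: injX.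
congr #|pred_of_set _|; apply/setP => P; rewrite !inE.
suff -> : R :\: pair4 c (phi c) :\: \bigcup_(c0 in X1) pair4 c0 (phi c0) =
  R :\: \bigcup_(c0 in X) pair4 c0 (phi c0) by [].
rewrite setDDl; congr (R :\: _); apply/setP => e; rewrite in_setU.
apply/orP/bigcupP => [[ep|/bigcupP[y + ey]]|[y yX ey]].
- by exists c.
- by rewrite inE => /andP[_ yX]; exists y.
- have [yX1|] := boolP (y \in X1); first by right; apply/bigcupP; exists y.
  rewrite !inE yX andbT negbK => /orP[]/eqP yE; left.
    by move: ey; rewrite yE !inE.
  move: ey; rewrite /pair4 (E y) // yE !half_turnK !inE.
  by do 4![case: (e == _)].
Qed.

End Forced.

(** * Nonintersecting paths in the upper half of the region *)

Section Region.
Variables (x y z k h o : nat).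
Hypotheses (xzo : x + z = o.*2) (yzh : y + z = h.*2).

Let xzo2 : (x + z)./2 = o. Proof. by rewrite xzo doubleK. Qed.
Let yzh2 : (y + z)./2 = h. Proof. by rewrite yzh doubleK. Qed.

(** Meant for heights [j] at least [h] only, where the lower lobe has no triangle. *)
Definition up_in_B (i j : nat) :=
  [&& i < x + z, z <= i + j, i + j < x + y + z & ~~ ((o <= i) && (i + j < o + h + k))].

Definition down_in_B (i j : nat) :=
  [&& i < x + z, z <= i + j.+1, i + j.+1 < x + y + z & ~~ ((o <= i) && (i + j.+1 < o + h + k))].

Lemma mem_B_up (i : 'I_(x + z)) (j : 'I_(y + z)) :
  h <= j -> ((i, j, false) \in B x y z k) = up_in_B i j.
Proof.
move=> lehj; have := ltn_ord i; have := ltn_ord j.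
rewrite !inE /= /in_hexagon /in_upper_lobe /in_lower_lobe /up_in_B /= xzo2 yzh2.
move: (nat_of_ord i) (nat_of_ord j) lehj => {}i {}j lehj lj li.
lia.
Qed.

Lemma mem_B_down (i : 'I_(x + z)) (j : 'I_(y + z)) :
  h <= j -> ((i, j, true) \in B x y z k) = down_in_B i j.
Proof.
move=> lehj; have := ltn_ord i; have := ltn_ord j.
rewrite !inE /= /in_hexagon /in_upper_lobe /in_lower_lobe /down_in_B /= xzo2 yzh2.
move: (nat_of_ord i) (nat_of_ord j) lehj => {}i {}j lehj lj li.
lia.
Qed.

Lemma half_turn_hexagon c : (half_turn c \in hexagon x y z) = (c \in hexagon x y z).
Proof.
case: c => [[i j] s]; have := ltn_ord i; have := ltn_ord j.
case: s; rewrite !inE /= /in_hexagon /=; lia.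
Qed.

Lemma half_turn_bowtie (c : cell (x + z) (y + z)) :
  (half_turn c \in bowtie _ _ (o, h) k) = (c \in bowtie _ _ (o, h) k).
Proof.
case: c => [[i j] s]; have := ltn_ord i; have := ltn_ord j.
rewrite /bowtie [LHS]inE [RHS]inE [LHS]orbC => lj li; case: s; congr orb;
rewrite /= /in_upper_lobe /in_lower_lobe /=; lia.
Qed.

Lemma half_turn_B c : (half_turn c \in B x y z k) = (c \in B x y z k).
Proof.
by rewrite /B xzo2 yzh2 !in_setD half_turn_hexagon half_turn_bowtie.
Qed.

(** Such a triangle would have the center of rotation as midpoint of an edge, whereas the center is
    the lattice point [(o, h)]. *)
Lemma not_adjacent_half_turn (c : cell (x + z) (y + z)) : ~~ adjacent c (half_turn c).
Proof.
case: c => [[i j] s]; have := ltn_ord i; have := ltn_ord j.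
rewrite adjacentE; case: s; rewrite /=; lia.
Qed.
End Region.

(** * Covering the upper half strip by strip *)

Section States.
Variables (x y z k h o : nat).
Hypotheses (xzo : x + z = o.*2) (yzh : y + z = h.*2).

Notation Cell := (cell (x + z) (y + z)).
Notation upB := (up_in_B x y z k h o).
Notation downB := (down_in_B x y z k h o).

Let memup := @mem_B_up x y z k h o xzo yzh.
Let memdown := @mem_B_down x y z k h o xzo yzh.

Definition upd (f : nat -> nat) l p t := if t == l then p else f t.

(* Paths cross the strips from the top down.  In this state the strips above j
   are covered, and in strip j the first l of the x paths have been followed:
   these stand at the positions f t on the bottom line of strip j, the others at
   the positions f t on its top line.  The cells left in strip j are the
   down-pointing ones above which a path waits and the up-pointing ones that no
   path has reached; below it everything is left. *)
Definition upper_state j l (f : nat -> nat) (c : Cell) :=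
  (h <= c.1.2) &&
  ((c.1.2 < j) && (c \in B x y z k)
   || (c.1.2 == j :> nat) &&
      (if c.2 then val c.1.1 \in map f (iota l (x - l))
       else (c \in B x y z k) && (val c.1.1 \notin map f (iota 0 l)))).

Definition state j l f :=
  [set c | upper_state j l f c || upper_state j l f (half_turn c)].

Lemma mem_state j l f c :
  (c \in state j l f) = upper_state j l f c || upper_state j l f (half_turn c).
Proof. by rewrite inE. Qed.

Lemma half_turn_state j l f : (@half_turn _ _) @: state j l f = state j l f.
Proof.
apply/setP => c; apply/imsetP/idP => [[d dS ->]|cS].
  by rewrite inE half_turnK orbC; rewrite inE in dS.
by exists (half_turn c); rewrite ?half_turnK // inE half_turnK orbC; rewrite inE in cS.
Qed.

Lemma upper_state_low j l f (c : Cell) : c.1.2 < h -> upper_state j l f c = false.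
Proof. by rewrite /upper_state ltnNge => /negPf ->. Qed.

Lemma row_half_turn (c : Cell) : h <= c.1.2 -> (half_turn c).1.2 < h.
Proof. case: c => [[i r] s] /=; have := ltn_ord r; lia. Qed.

Lemma mem_state_up j l f (c : Cell) : h <= c.1.2 ->
  (c \in state j l f) = upper_state j l f c.
Proof.
by move=> hc; rewrite inE (@upper_state_low j l f (half_turn c)) ?orbF ?row_half_turn.
Qed.

(** The comparison between a path that has moved and one that waits is only weak: the first may have
    stepped right, to the position at which the second waits, and then the second must step right
    too. *)
Definition valid j l (f : nat -> nat) :=
  [/\ forall s t, s < t < x -> (t < l) || (l <= s) -> f s < f t,
      forall s t, s < l -> l <= t < x -> f s <= f t,
      forall t, t < l -> upB (f t) j
    & forall t, l <= t < x -> downB (f t) j].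

(** The down-pointing triangle on which path [l] waits has three neighbours. The one in strip
    [j + 1] is already covered; the two others are the two possible steps of the path, subject to
    being in the region and not taken by an earlier path. *)
Lemma peel_state j l f : h <= j < y + z -> l < x -> valid j l f ->
  #|tilings (state j l f)| =
  \sum_(i < x + z | ((i == f l :> nat) || (i == (f l).+1 :> nat)) &&
          (upB i j && (val i \notin map f (iota 0 l))))
     #|tilings (state j l.+1 (upd f l i))|.
Proof.
move=> /andP[lehj ltjn] ltlx [V1 V2 V3 V4].
have /and4P[ltf _ _ _] : downB (f l) j by apply: V4; rewrite leqnn.
pose jo := Ordinal ltjn; pose c : Cell := (Ordinal ltf, jo, true).
have iotal : iota l (x - l) = l :: iota l.+1 (x - l.+1).
  by rewrite subnS; case: (x - l) (subn_gt0 l x) => [|p]; rewrite ?ltlx.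
have cS : c \in state j l f.
  rewrite mem_state_up // /upper_state /= lehj ltnn eqxx /=.
  by rewrite iotal /= mem_head.
rewrite (card_tilings_peel (not_adjacent_half_turn xzo yzh) (half_turn_state _ _ _) cS).
rewrite (reindex_onto (fun i => (i, jo, false)) (fun d : Cell => d.1.1)) /=; last first.
  move=> [[i r] s] /andP[dS]; rewrite adjacentE /=; case: s dS => //= dS adj.
  congr (_, _, _); apply/val_inj => /=.
  have : r <= j; last by lia.
  rewrite leqNgt; apply/negP => ltjr; move: dS; rewrite mem_state_up /=; last by lia.
  by rewrite /upper_state /=; lia.
apply: eq_big => [i|i].
  rewrite eqxx andbT adjacentE /= mem_state_up // /upper_state /= lehj ltnn eqxx /=.
  rewrite memup // andbC; congr andb.
  rewrite [j.+1 == j]gtn_eqF // andbF orbF andbT andbT.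
  by rewrite eq_sym [(f l).+1 == _]eq_sym.
case/andP=> /andP[dS ad] _; congr #|pred_of_set _|; apply/setP => P; rewrite !inE.
suff -> : state j l f :\: pair4 c (i, jo, false) = state j l.+1 (upd f l i) by [].
have US e : upper_state j l.+1 (upd f l i) e =
    upper_state j l f e && (e \notin [set c; (i, jo, false)]).
  move: e => [[i' r] s]; rewrite /upper_state /= in_set2 !xpair_eqE -!val_eqE /=.
  case: (leqP h r) => //= hr; case: ltngtP => //= rj.
  - by rewrite !andbF andbT.
  - rewrite !andbT; case: s => /=; rewrite ?andbT ?andbF ?orbF.
      have -> : map (upd f l i) (iota l.+1 (x - l.+1)) = map f (iota l.+1 (x - l.+1)).
        apply/eq_in_map => t; rewrite mem_iota /upd => /andP[lt _].
        by rewrite gtn_eqF.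
      rewrite iotal map_cons in_cons; case: eqP => [->|_]; last by rewrite andbT.
      rewrite andbF; apply/negP => /mapP[t]; rewrite mem_iota => /andP[lt ltx] E.
      have : f l < f t by apply: V1; rewrite ?leqnn ?orbT // lt /=; lia.
      by rewrite E ltnn.
    rewrite -[upd f l i 0 :: _]/(map (upd f l i) (iota 0 l.+1)) -addn1 iotaD map_cat.
    rewrite mem_cat /= negb_or mem_seq1 /upd eqxx andbA.
    congr (_ && (_ \notin _) && _); apply/eq_in_map => t; rewrite mem_iota => ?.
    by rewrite ltn_eqF //; lia.
have pairE e : (e \in pair4 c (i, jo, false)) =
    (e \in [set c; (i, jo, false)]) || (half_turn e \in [set c; (i, jo, false)]).
  rewrite /pair4 in_setU; congr orb.
  by rewrite !in_set2 !(inv_eq (@half_turnK _ _)).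
have lowN (e : Cell) : e.1.2 < h -> (e \in [set c; (i, jo, false)]) = false.
  by move=> lt; apply/negP => /set2P[] E; move: lt; rewrite E /= ltnNge lehj.
apply/setP => e; rewrite in_setD pairE !mem_state !US.
case: (leqP h e.1.2) => he.
  rewrite !(upper_state_low _ _ _ (row_half_turn he)) (lowN _ (row_half_turn he)).
  by rewrite !andFb !orbF andbC.
by rewrite !(upper_state_low _ _ _ he) (lowN _ he) /= andbC.
Qed.

(** The triangle across the horizontal side of an up-pointing [c]. As [ord_pred] is cyclic, this is
    meaningful only in rows of positive index. *)
Definition below (c : Cell) : Cell := (c.1.1, ord_pred c.1.2, true).

Lemma val_below (c : Cell) : 0 < c.1.2 -> (below c).1.2 = c.1.2.-1 :> nat.
Proof.
case: c => [[i r] s] /=; have := ltn_ord r => ltr lt0.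
have -> : (r + (y + z)).-1 = r.-1 + (y + z) by lia.
by rewrite modnDr modn_small //; lia.
Qed.

Lemma adjacent_below (c : Cell) : ~~ c.2 -> 0 < c.1.2 -> adjacent c (below c).
Proof.
move=> c2 c0; rewrite adjacentE (negPf c2) /= eqxx /=.
have := val_below c0; rewrite /= => ->; lia.
Qed.

Lemma adjacent_up_unique (c d : Cell) : ~~ c.2 -> 0 < c.1.2 -> adjacent c d ->
  (d.1.2 = c.1.2 :> nat -> False) -> d = below c.
Proof.
move=> c2 c0; rewrite adjacentE; have := val_below c0.
case: c c2 c0 => [[i r] []] // _; case: d => [[i' r'] []] //= r0 E adj ne.
rewrite /below /=; congr (_, _, _); apply/val_inj; rewrite /= ?E; lia.
Qed.

Lemma upper_row_down j f (c : Cell) : c.1.2 = j :> nat -> c.2 ->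
  upper_state j x f c = false.
Proof. by move=> cj c2; rewrite /upper_state cj ltnn eqxx c2 subnn /= andbF. Qed.

(** Once all paths have crossed strip [j + 1], the up-pointing triangles left there have lost their
    neighbours in the strip and must be matched with the triangles below them. This uses up the
    down-pointing triangles of strip [j] on which no path waits. *)
Lemma forced_state j f : h <= j -> j.+1 < y + z -> valid j.+1 x f ->
  #|tilings (state j.+1 x f)| = #|tilings (state j 0 f)|.
Proof.
move=> lehj ltjn [V1 V2 V3 V4].
pose X := [set c in state j.+1 x f | ~~ c.2 & c.1.2 == j.+1 :> nat].
have XE c : c \in X = [&& ~~ c.2, c.1.2 == j.+1 :> nat, upB (val c.1.1) j.+1
     & val c.1.1 \notin map f (iota 0 x)].
  rewrite inE andbC -andbA; case: c => [[i r] []] //=; case: eqP => //= rj.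
  rewrite mem_state_up /=; last by rewrite rj; lia.
  by rewrite /upper_state /= rj ltnn eqxx (leqW lehj) /= memup ?rj ?(leqW lehj).
have up_down (i : nat) : upB i j.+1 = downB i j.
  by rewrite /up_in_B /down_in_B; lia.
rewrite (card_tilings_forced (not_adjacent_half_turn xzo yzh)
  (half_turn_state _ _ _) (X := X) (phi := below)); first last.
- move=> [[i r] s] [[i' r'] s']; rewrite !XE /= => /and4P[/negPf-> /eqP rj _ _].
  case/and4P=> /negPf-> /eqP rj' _ _ [] -> _; congr (_, _, _).
  by apply/val_inj; rewrite /= rj rj'.
- move=> c cX; have := cX; rewrite XE => /and4P[c2 /eqP cj cu cf].
  have c0 : 0 < c.1.2 by rewrite cj.
  split=> //.
  + by move: cX; rewrite inE => /andP[].
  + have bE : (below c).1.2 = j :> nat by rewrite val_below // cj.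
    have bB : (below c \in B x y z k) = downB (val c.1.1) j.
      by rewrite -bE; apply: memdown; rewrite -[nat_of_ord _]/(nat_of_ord (below c).1.2) bE.
    by rewrite mem_state_up ?bE // /upper_state bE lehj leqnn bB -up_down cu.
  + exact: adjacent_below.
  + move=> d dS ad; apply: adjacent_up_unique => // dj.
    move: dS; rewrite mem_state_up ?upper_row_down // ?dj ?cj //; last by lia.
    by move: ad; rewrite adjacentE (negPf c2); case: d.2.
(* [w] describes the triangles of the forced lozenges themselves, without their images: those of
   [X], and those just below them in row [j]. *)
pose w (e : Cell) := (e \in X) || [&& e.2, e.1.2 == j :> nat, upB (val e.1.1) j.+1
     & val e.1.1 \notin map f (iota 0 x)].
have wE e : (e \in \bigcup_(c in X) pair4 c (below c)) = w e || w (half_turn e).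
  have wP u : reflect (exists2 c, c \in X & u \in [set c; below c]) (w u).
    apply: (iffP orP) => [[uX|/and4P[u2 /eqP uj uu uf]]|[c cX /set2P[]->]].
    - by exists u; rewrite // set21.
    - pose c : Cell := (u.1.1, Ordinal ltjn, false).
      exists c; first by rewrite XE /= eqxx uu uf.
      apply/set2P; right; rewrite /below /=; case: u u2 uj {uu uf} @c => [[i r] []] //= _ rj.
      congr (_, _, _); apply/val_inj; rewrite /= rj modnDr modn_small //; lia.
    - by left.
    - right; move: cX; rewrite XE => /and4P[c2 /eqP cj cu cf].
      by apply/and4P; split=> //; rewrite val_below cj.
  apply/bigcupP/orP => [[c cX]|].
    rewrite /pair4 in_setU => /orP[] H; [left|right]; apply/wP; exists c => //.
    by move: H; rewrite !in_set2 !(inv_eq (@half_turnK _ _)).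
  case=> /wP[c cX cH]; exists c => //; rewrite /pair4 in_setU ?cH //.
  by move: cH; rewrite !in_set2 !(inv_eq (@half_turnK _ _)) => ->; rewrite orbT.
have US e : upper_state j 0 f e = upper_state j.+1 x f e && ~~ w e.
  rewrite /w XE; case: e => [[i r] s]; rewrite /upper_state /= subnn.
  case: (leqP h r) => //= hr; case: (ltngtP r j.+1) => rj /=.
  - case: (ltngtP r j) rj => [rj _|ltjr|rj _]; first 1 last.
    + by rewrite ltnS leqNgt ltjr.
    + case: s => /=; last by rewrite andbT orbF andbT.
      rewrite subn0 orbF memdown // rj -up_down; case: (boolP (_ \in _)) => [/mapP[t]|_].
        by rewrite mem_iota add0n => /V3 + -> => ->.
      by rewrite andbT andbN.
    + by rewrite !andbF orbF andbT.
  - by rewrite gtn_eqF ?ltnNge ?(ltnW rj) //; lia.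
  - rewrite rj gtn_eqF // ltnNge leqnSn /=.
    by case: s => /=; rewrite ?memup ?rj ?orbF ?andbN // leqW.
have lowN (e : Cell) : e.1.2 < h -> w e = false.
  by rewrite /w XE => lt; apply/negP => /orP[]/and4P[_ /eqP E _ _]; move: lt; rewrite E; lia.
congr #|pred_of_set _|; apply/setP => P; rewrite !inE.
suff -> : state j.+1 x f :\: \bigcup_(c in X) pair4 c (below c) = state j 0 f by [].
apply/setP => e; rewrite in_setD wE !mem_state !US.
case: (leqP h e.1.2) => he.
  rewrite !(upper_state_low _ _ _ (row_half_turn he)) (lowN _ (row_half_turn he)).
  by rewrite !andFb !orbF andbC.
by rewrite !(upper_state_low _ _ _ he) (lowN _ he) /= andbC.
Qed.
(** The up-pointing triangles left just above the central line, as positions, have to form a set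
    that the half turn preserves. *)
Definition mid_sym (f : seq nat) :=
  [forall i : 'I_(x + z), (upB i h && (val i \notin f)) ==
     (upB (rev_ord i) h && (val (rev_ord i) \notin f))].

(** The triangle below position [i] is the half turn of the up-pointing one at [rev_ord i]. So each
    triangle left above the central line has its only possible partner available exactly when the
    mirrored position is left too. If this always holds, the tiling is completed in one way;
    otherwise some triangle has no partner. *)
Lemma middle_state f : 0 < h -> valid h x f ->
  #|tilings (state h x f)| = mid_sym (map f (iota 0 x)).
Proof.
move=> h0 [V1 V2 V3 V4].
have lthn : h < y + z by lia.
pose ho := Ordinal lthn.
have SE (i : 'I_(x + z)) (r : 'I_(y + z)) : r = h :> nat ->
    ((i, r, false) \in state h x f) = upB i h && (val i \notin map f (iota 0 x)).
  move=> rh; rewrite mem_state_up //= ?rh //.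
  by rewrite /upper_state /= rh leqnn ltnn eqxx /= memup ?rh.
have below_turn (i : 'I_(x + z)) (r : 'I_(y + z)) : r = h :> nat ->
    half_turn (below (i, r, false)) = (rev_ord i, ho, false).
  move=> rh; rewrite /below /=; congr (_, _, _); apply/val_inj => /=.
  have /= -> := @val_below (i, r, false); rewrite /= rh //; lia.
have Sbelow (i : 'I_(x + z)) (r : 'I_(y + z)) : r = h :> nat ->
    (below (i, r, false) \in state h x f) =
    upB (rev_ord i) h && (val (rev_ord i) \notin map f (iota 0 x)).
  by move=> rh; rewrite -(SE (rev_ord i) ho) // -(below_turn i r rh) !mem_state half_turnK orbC.
have uniq_nb (i : 'I_(x + z)) (r : 'I_(y + z)) d : r = h :> nat ->
    d \in state h x f -> adjacent (i, r, false) d -> d = below (i, r, false).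
  move=> rh dS ad; apply: adjacent_up_unique; rewrite //= ?rh // => dj.
  move: dS; rewrite mem_state_up ?upper_row_down // ?dj //.
  by move: ad; rewrite adjacentE; case: d.2.
have [/forallP sym|] := boolP (mid_sym _); last first.
  rewrite negb_forall => /existsP[i0 ne].
  suff [i /andP[iS niS]] : exists i : 'I_(x + z), ((i, ho, false) \in state h x f) &&
      (below (i, ho, false) \notin state h x f).
    rewrite (card_tilings_peel (not_adjacent_half_turn xzo yzh)
      (half_turn_state _ _ _) iS) big1 // => d /andP[dS ad].
    by move: niS; rewrite -(uniq_nb _ _ _ _ dS ad) ?dS.
  case E : (upB i0 h && (val i0 \notin map f (iota 0 x))) ne => ne.
    by exists i0; rewrite SE // Sbelow // E; case: (_ && _) ne.
  by exists (rev_ord i0); rewrite SE // Sbelow // rev_ordK E; case: (_ && _) ne.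
pose X := [set c in state h x f | ~~ c.2 & c.1.2 == h :> nat].
rewrite (card_tilings_forced (not_adjacent_half_turn xzo yzh)
  (half_turn_state _ _ _) (X := X) (phi := below)); first last.
- move=> [[i r] s] [[i' r'] s']; rewrite !inE /= => /and3P[_ /negPf-> /eqP rj].
  case/and3P=> _ /negPf-> /eqP rj' [] -> _; congr (_, _, _).
  by apply/val_inj; rewrite /= rj rj'.
- move=> [[i r] s]; rewrite inE /= => /and3P[]; case: s => //= cS _ /eqP rh.
  split=> //.
  + by rewrite Sbelow // -(eqP (sym i)) -(SE _ r).
  + by apply: adjacent_below; rewrite //= rh.
  + by move=> d; apply: uniq_nb.
rewrite (_ : _ :\: _ = set0) ?card_tilings0 //.
apply/setP => e; rewrite in_set0 in_setD andbC; apply/negP => /andP[eS /bigcupP].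
suff main (u : Cell) : upper_state h x f u -> u \in X.
  have sub (c : Cell) u : u \in pair4 c (below c) -> half_turn u \in pair4 c (below c).
    rewrite /pair4 !in_setU !in_set1 !(inj_eq (@half_turn_inj _ _)) !(inv_eq (@half_turnK _ _)).
    by rewrite orbC.
  case; move: eS; rewrite mem_state => /orP[] /main uX.
    by exists e => //; rewrite /pair4 !inE eqxx.
  exists (half_turn e) => //; rewrite -{1}(half_turnK e); apply: sub.
  by rewrite /pair4 !inE eqxx.
move=> us; rewrite inE mem_state us /=; move: us.
rewrite /upper_state; case: u.2 => /=; case: ltngtP => //=.
by rewrite subnn.
Qed.

(** The paths start at the positions 0, ..., x - 1 of the top side. The bound [k <= h] keeps the
    upper lobe away from the down-pointing triangles along that side. *)
Lemma top_state : k <= h -> 0 < h -> state (y + z).-1 0 id = B x y z k.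
Proof.
move=> lekh h0; have nE : (y + z).-1.+1 = y + z by lia.
have main (u : Cell) : h <= u.1.2 -> upper_state (y + z).-1 0 id u = (u \in B x y z k).
  case: u => [[i r] s] /= hr; rewrite /upper_state /= hr subn0 map_id mem_iota /= add0n.
  case: ltngtP => [_|lt|rE] /=; first by rewrite orbF.
    by have := ltn_ord r; lia.
  case: s; last by rewrite andbT.
  rewrite memdown // /down_in_B rE; have := ltn_ord i; lia.
apply/setP => e; rewrite mem_state; case: (leqP h e.1.2) => he.
  by rewrite (upper_state_low _ _ _ (row_half_turn he)) orbF main.
rewrite upper_state_low //= main ?(half_turn_B k xzo yzh) //.
by case: e he => [[i' r] s] /=; have := ltn_ord r; lia.
Qed.

Lemma top_valid : k <= h -> 0 < h -> valid (y + z).-1 0 id.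
Proof.
move=> lekh h0; split=> //; first by move=> s t /andP[].
move=> t /= ltx; rewrite /down_in_B; lia.
Qed.

Lemma forced_valid j f : h <= j -> valid j.+1 x f -> valid j 0 f.
Proof.
move=> lehj [V1 V2 V3 V4]; split=> // s t stx _.
by apply: V1; lia.
Qed.

Lemma peel_valid j l f i : h <= j -> l < x -> valid j l f ->
  (i == f l) || (i == (f l).+1) -> upB i j -> i \notin map f (iota 0 l) ->
  valid j l.+1 (upd f l i).
Proof.
move=> lehj ltlx [V1 V2 V3 V4] iE iB iN.
have lt_i t : t < l -> f t < i.
  move=> ltl; have := V2 t l ltl; rewrite leqnn ltlx => /(_ isT) le.
  have : f t != i by apply: contraNneq iN => <-; apply: map_f; rewrite mem_iota.
  lia.
have gt_i t : l < t < x -> i <= f t.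
  move=> /andP[lt tx]; have := V1 l t; rewrite lt tx leqnn orbT => /(_ isT isT); lia.
split=> [s t /andP[st tx] H|s t sl /andP[lt tx]|t tl|t /andP[lt tx]]; rewrite /upd.
- case: eqP => [sE|sN]; case: eqP => [tE|tN]; try lia.
  + by apply: lt_i; lia.
  + by apply: V1; lia.
- rewrite (gtn_eqF lt); case: eqP => [sE|sN]; first by apply: gt_i; lia.
  apply: V2; lia.
- case: eqP => // tN; apply: V3; lia.
- rewrite (gtn_eqF lt); apply: V4; lia.
Qed.

End States.

(* The number of paths from p to q in n steps of length 0 or 1; the test is
   needed because q - p is truncated. *)
Definition binom_diff n p q : rat := if p <= q then ('C(n, q - p))%:R%R else 0%R.

Lemma binom_diffS n p q :
  (binom_diff n.+1 p q = binom_diff n p q + binom_diff n p.+1 q)%R.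
Proof.
rewrite /binom_diff; case: (ltngtP p q) => [lt|lt|->].
- by rewrite -(subnSK lt) binS natrD.
- by rewrite addr0.
- by rewrite subnn !bin0 addr0.
Qed.

Lemma binom_diff0 n p q : ~~ (p <= q <= p + n) -> binom_diff n p q = 0%R.
Proof.
rewrite /binom_diff; case: leqP => //= lepq lt.
by rewrite bin_small //; lia.
Qed.

Lemma sorted_enum_val m (A : {set 'I_m}) : sorted ltn (map val (enum A)).
Proof.
rewrite sorted_map /enum_mem; apply: sorted_filter.
  by move=> u v w /= ; apply: ltn_trans.
by rewrite -sorted_map -enumT val_enum_ord iota_ltn_sorted.
Qed.

Lemma det_row_zero (R : comRingType) n (M : 'M[R]_n) i :
  (forall j, M i j = 0)%R -> (\det M = 0)%R.
Proof.
by move=> M0; rewrite (expand_det_row M i) big1 // => j _; rewrite M0 mul0r.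
Qed.

(** Replaces a sum over the allowed moves of a path by the sum of both moves, when a forbidden move
    contributes zero. *)
Lemma sum_ord_two (V : zmodType) m p (good : pred nat) (G : nat -> V) :
    (forall i, (i == p) || (i == p.+1) -> good i -> i < m) ->
    (forall i, (i == p) || (i == p.+1) -> ~~ good i -> G i = 0%R) ->
  (\sum_(i < m | ((i == p :> nat) || (i == p.+1 :> nat)) && good i) G i = G p + G p.+1)%R.
Proof.
move=> H1 H2.
have -> : (\sum_(i < m | ((i == p :> nat) || (i == p.+1 :> nat)) && good i) G i =
   \sum_(0 <= i < m | ((i == p) || (i == p.+1)) && good i) G i)%R by rewrite big_mkord.
(* The range is enlarged so as to contain [p] and [p.+1], which may lie beyond [m]. *)
rewrite (big_nat_widen 0 m (m + p.+2)) ?leq_addr //.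
under eq_bigl => i do rewrite -andbA.
have -> : (\sum_(0 <= i < m + p.+2 | [&& (i == p) || (i == p.+1), good i & (i < m)%N]) G i =
   \sum_(0 <= i < m + p.+2 | (i == p) || (i == p.+1)) G i)%R.
  rewrite big_mkcondr; apply: eq_bigr => i ip.
  by case: (boolP (good i)) => [/(H1 _ ip) -> //|/(H2 _ ip) ->].
rewrite big_mkord (bigD1 (Ordinal (_ : p < m + p.+2))) /=; last by rewrite eqxx.
  lia.
move=> ltp; rewrite (big_pred1 (Ordinal (_ : p.+1 < m + p.+2))) //=.
  lia.
move=> ltp1 i; rewrite -val_eqE /= -!val_eqE /=; lia.
Qed.

(** * Counting the coverings by determinants *)

Section Count.
Variables (x y z k h o : nat).
Hypotheses (xzo : x + z = o.*2) (yzh : y + z = h.*2) (lekh : k <= h).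
Hypothesis h0 : 0 < h.

Notation upB := (up_in_B x y z k h o).
Notation downB := (down_in_B x y z k h o).
Notation state := (@state x y z k h).
Notation valid := (@valid x y z k h o).

(* The Lindstrom-Gessel-Viennot matrix of paths of e steps starting from f t,
   those with l <= t having one more step to go. *)
Definition path_mx e l (f : nat -> nat) (A : seq nat) : 'M[rat]_x :=
  (\matrix_(t < x, s < x) binom_diff (e + (l <= t)) (f t) (nth 0%N A s))%R.

Definition admissible (A : {set 'I_(x + z)}) :=
  [&& #|A| == x, [forall i in A, upB (val i) h] & mid_sym x y z k h o (map val (enum A))].

Lemma admissible_nth (A : {set 'I_(x + z)}) (s : 'I_x) : admissible A ->
  exists2 i, i \in A & nth 0 (map val (enum A)) s = val i.
Proof.
case/and3P=> /eqP cA _ _; have sz : s < size (enum A) by rewrite -cardE cA.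
have /mapP[i iA E] : nth 0 (map val (enum A)) s \in map val (enum A).
  by apply: mem_nth; rewrite size_map.
by exists i; rewrite // -mem_enum.
Qed.

(** Pascal's rule splits row [l] according to the next step of path [l], and the determinant is
    linear in that row. *)
Lemma path_mx_step e l f A (ltlx : l < x) :
  (\det (path_mx e l f A) = \det (path_mx e l.+1 (upd f l (f l)) A) +
                            \det (path_mx e l.+1 (upd f l (f l).+1) A))%R.
Proof.
rewrite -[X in (X + _)%R]mul1r -[X in (_ + X)%R]mul1r.
apply: (@determinant_multilinear _ _ _ _ _ (Ordinal ltlx)).
- apply/rowP => s; rewrite !mxE /= /upd eqxx leqnn ltnn addn1 addn0 !mul1r.
  exact: binom_diffS.
- apply/matrixP => t s; rewrite !mxE /upd /=.
  have ne : bump l t != l by rewrite eq_sym neq_bump.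
  by rewrite (negPf ne) ltn_neqAle eq_sym ne.
- apply/matrixP => t s; rewrite !mxE /upd /=.
  have ne : bump l t != l by rewrite eq_sym neq_bump.
  by rewrite (negPf ne) ltn_neqAle eq_sym ne.
Qed.

(* A move out of the region or onto an occupied position: no path starting there
   ends in A, or two rows are equal. *)
Lemma path_mx_dead j l f i A : h <= j -> l < x -> admissible A -> valid j l f ->
    (i == f l) || (i == (f l).+1) -> ~~ (upB i j && (i \notin map f (iota 0 l))) ->
  (\det (path_mx (j - h) l.+1 (upd f l i) (map val (enum A))) = 0)%R.
Proof.
move=> lehj ltlx admA [V1 V2 V3 V4] ip; rewrite negb_and negbK => /orP[nB|].
  apply: (@det_row_zero _ _ _ (Ordinal ltlx)) => s; rewrite mxE /= /upd eqxx ltnn addn0.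
  have [q qA ->] := admissible_nth s admA.
  (* Going out of the region is irreversible: a path that crosses the left boundary or enters the
     lobe can only reach points of the central line left of the region or on the bottom side of the
     lobe, and one beyond the right end stays there. *)
  apply: binom_diff0; have /and3P[_ /forall_inP/(_ q qA) + _] := admA.
  have : downB (f l) j by apply: V4; rewrite leqnn.
  move: nB (ltn_ord q) ip; rewrite /up_in_B /down_in_B /=; lia.
case/mapP=> t; rewrite mem_iota => /= ltl iE.
have ltx : t < x by lia.
apply: (@determinant_alternate _ _ _ (Ordinal ltx) (Ordinal ltlx)).
  by rewrite -val_eqE /= ltn_eqF.
by move=> s; rewrite !mxE /= /upd eqxx (ltn_eqF ltl) -iE ltnn ltnNge ltnW.
Qed.

(** With no step left the matrix compares [f] with [A]: it is the identity if [A] is the set [F] of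
    the positions of the paths, and otherwise a position outside [A] gives a zero row. Both sides
    thus test whether [F] is admissible. *)
Lemma count_middle f : valid h x f ->
  ((#|tilings (state h x f)|)%:R =
    \sum_(A | admissible A) \det (path_mx 0 x f (map val (enum A))))%R.
Proof.
move=> V; rewrite (middle_state xzo yzh) //; have [V1 V2 V3 V4] := V.
have f_inj : {in [pred t | t < x] &, injective f}.
  move=> s t; rewrite !inE => sx tx E; apply/eqP; case: (ltngtP s t) => // lt.
    by have := V1 s t; rewrite lt tx E ltnn => /(_ isT isT).
  by have := V1 t s; rewrite lt sx E ltnn => /(_ isT isT).
pose F : {set 'I_(x + z)} := [set i | val i \in map f (iota 0 x)].
have fm t : t < x -> f t < x + z by move=> /V3/and4P[].
have FE : map val (enum F) = map f (iota 0 x).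
  apply: (irr_sorted_eq ltn_trans ltnn); first exact: sorted_enum_val.
    apply: (homo_sorted_in (P := [pred t | t < x]) (e := ltn)); last exact: iota_ltn_sorted.
      move=> s t; rewrite !inE /= => sx tx lt; apply: (V1 s t); lia.
    by apply/allP => t; rewrite mem_iota.
  move=> i; apply/mapP/mapP => [[q]|[t]].
    by rewrite mem_enum inE => /mapP[t tx ->] ->; exists t.
  rewrite mem_iota => /= tx ->; exists (Ordinal (fm t tx)) => //.
  by rewrite mem_enum inE /=; apply: map_f; rewrite mem_iota.
have cF : #|F| = x by rewrite cardE -(size_map val) FE size_map size_iota.
have f0 t : t < x -> exists2 q : 'I_(x + z), val q = f t & q \in F.
  move=> tx; exists (Ordinal (fm t tx)); rewrite // inE /=.
  by apply: map_f; rewrite mem_iota.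
have detF (A : {set 'I_(x + z)}) : admissible A ->
    (\det (path_mx 0 x f (map val (enum A))) = (A == F)%:R)%R.
  move=> admA; have [->|ne] := eqVneq A F.
    rewrite FE (_ : path_mx _ _ _ _ = 1%:M)%R ?det1 //.
    apply/matrixP => t s; rewrite !mxE leqNgt ltn_ord /= (nth_map 0) ?size_iota //.
    rewrite nth_iota // add0n.
    have [<-|ts] := eqVneq t s; first by rewrite /binom_diff leqnn subnn bin0.
    apply: binom_diff0; rewrite addn0 -eqn_leq; apply: contra ts => /eqP/f_inj E.
    by apply/eqP/val_inj/E; rewrite inE /= ltn_ord.
  have : ~~ (F \subset A).
    apply: contra ne => FA; rewrite eq_sym eqEcard FA cF.
    by have /and3P[/eqP -> _ _] := admA; rewrite leqnn.
  case/subsetPn=> i; rewrite inE => /mapP[t]; rewrite mem_iota => /= tx iE iA.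
  apply: (@det_row_zero _ _ _ (Ordinal tx)) => s; rewrite mxE leqNgt tx /=.
  have [q qA ->] := admissible_nth s admA.
  apply: binom_diff0; rewrite -iE; apply: contra iA => H.
  by rewrite (_ : i = q) //; apply/val_inj; move: H => /=; lia.
rewrite (eq_bigr _ detF) -FE.
have -> : mid_sym x y z k h o (map val (enum F)) = admissible F.
  rewrite /admissible cF eqxx /= andbC; case: (mid_sym _ _ _ _ _ _ _) => //=.
  apply/esym/forall_inP => i; rewrite inE => /mapP[t]; rewrite mem_iota => /= tx ->.
  exact: V3.
case admF: (admissible F); last first.
  by rewrite big1 // => A admA; case: eqP => // AF; rewrite AF admF in admA.
rewrite (bigD1 F) //= eqxx big1 ?addr0 // => A /andP[_ /negPf -> //].
Qed.

Definition counted j l f := ((#|tilings (state j l f)|)%:R =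
    \sum_(A | admissible A) \det (path_mx (j - h) l f (map val (enum A))))%R.

(** Induction on the number of waiting paths. The recursion [peel_state] matches [path_mx_step],
    because the moves that it excludes have zero determinant. *)
Lemma count_row j : h <= j < y + z ->
    (forall f, valid j x f -> counted j x f) ->
  forall l f, l <= x -> valid j l f -> counted j l f.
Proof.
move=> hj Hx l f lelx; move: {2}(x - l) (leqnn (x - l)) => p.
elim: p l f lelx => [|p IHp] l f lelx lep V.
  have lE : l = x by lia.
  by rewrite lE in V *; apply: Hx.
have [lE|ltlx] := eqVneq l x; first by rewrite lE in V *; apply: Hx.
have {}ltlx : l < x by lia.
have /andP[lehj _] := hj.
rewrite /counted (peel_state xzo yzh hj ltlx V) natr_sum.
under eq_bigr => i /andP[ip /andP[iB iN]].
  have -> : ((#|tilings (state j l.+1 (upd f l i))|)%:R = \sum_(A | admissible A)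
      \det (path_mx (j - h) l.+1 (upd f l i) (map val (enum A))))%R.
    apply: IHp; rewrite //; first by lia.
    exact: (peel_valid xzo yzh).
  over.
rewrite (sum_ord_two (good := fun i => upB i j && (i \notin map f (iota 0 l)))
  (G := fun i => \sum_(A | admissible A)
      \det (path_mx (j - h) l.+1 (upd f l i) (map val (enum A))))%R).
- rewrite -big_split /=; apply: eq_bigr => A admA.
  by rewrite -path_mx_step.
- by move=> i _ /andP[/and4P[]].
- by move=> i ip ng; apply: big1 => A admA; apply: (path_mx_dead (j := j)).
Qed.

Lemma count_state j l f : h <= j < y + z -> l <= x -> valid j l f -> counted j l f.
Proof.
elim: j l f => [|j IHj] l f /andP[lehj ltjn] lelx V.
  by move: h0; rewrite ltnNge lehj.
apply: count_row V => //; first by rewrite lehj.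
move=> {l lelx} {}f V; rewrite /counted.
have [hE|hE] := eqVneq h j.+1.
  by rewrite -hE subnn in V *; apply: count_middle.
have lehj' : h <= j by lia.
rewrite (forced_state xzo yzh lehj' ltjn V) IHj //; last 2 first.
- by rewrite lehj' ltnW.
- exact: (forced_valid xzo yzh).
(* With [l = 0] every path has one more step to go and with [l = x] none, which makes up for the
   change of strip. *)
apply: eq_bigr => A admA; congr (\det _)%R; apply/matrixP => t s; rewrite !mxE.
by congr binom_diff; have := ltn_ord t; lia.
Qed.

Theorem M_odot_B : ((M_odot (B x y z k))%:R =
  \sum_(A | admissible A)
     \det (\matrix_(t < x, s < x) binom_diff h t (nth 0%N (map val (enum A)) s)))%R.
Proof.
rewrite /M_odot -(top_state xzo yzh lekh h0).
rewrite count_state //; [|lia|exact: (top_valid xzo yzh lekh)].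
apply: eq_bigr => A admA; congr (\det _)%R; apply/matrixP => t s; rewrite !mxE /=.
by congr binom_diff; lia.
Qed.
End Count.

Local Open Scope ring_scope.

(** * Determinants *)

Lemma det_scale (R : comRingType) n (a b : 'I_n -> R) (m : 'I_n -> 'I_n -> R) :
  \det (\matrix_(i, j) (a i * b j * m i j)) =
  (\prod_i a i) * (\prod_i b i) * \det (\matrix_(i, j) m i j).
Proof.
have -> : \matrix_(i, j) (a i * b j * m i j) =
    diag_mx (\row_i a i) *m (\matrix_(i, j) m i j) *m diag_mx (\row_i b i).
  by apply/matrixP => i j; rewrite mul_mx_diag mul_diag_mx !mxE mulrAC.
rewrite !det_mulmx !det_diag mulrAC; congr (_ * _ * _).
  by apply: eq_bigr => i _; rewrite mxE.
by apply: eq_bigr => i _; rewrite mxE.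
Qed.

Lemma prod_rev_ord (R : comRingType) n (F : nat -> R) :
  \prod_(i < n) F (rev_ord i) = \prod_(i < n) F i.
Proof. by rewrite [RHS](reindex_inj rev_ord_inj). Qed.

Lemma det_rev (R : comRingType) n (M : 'M[R]_n) :
  \det (\matrix_(i, j) M (rev_ord i) (rev_ord j)) = \det M.
Proof.
pose s : 'S_n := perm (@rev_ord_inj n).
have -> : \matrix_(i, j) M (rev_ord i) (rev_ord j) = row_perm s (col_perm s M).
  by apply/matrixP => i j; rewrite !mxE !permE.
rewrite row_permE col_permE !det_mulmx !det_perm odd_permV mulrCA.
by rewrite -signr_addb addbb mulr1.
Qed.

(** The coefficient matrix of the polynomials is unitriangular, and multiplying it by the
    Vandermonde matrix gives the matrix of values. *)
Lemma det_monic (R : comRingType) n (p : 'I_n -> {poly R}) (v : 'I_n -> R) :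
    (forall i, p i \is monic) -> (forall i, size (p i) = i.+1) ->
  \det (\matrix_(i, j) (p i).[v j]) =
  \prod_(i < n) \prod_(j < n | (i < j)%N) (v j - v i).
Proof.
move=> pm ps.
have -> : \matrix_(i, j) (p i).[v j] =
    (\matrix_(i, l) (p i)`_l) *m Vandermonde n (\row_j v j).
  apply/matrixP => i j; rewrite !mxE (@horner_coef_wide _ n) ?ps ?ltn_ord //.
  by apply: eq_bigr => l _; rewrite !mxE.
rewrite det_mulmx det_Vandermonde det_trig; last first.
  apply/is_trig_mxP => i j lt; rewrite mxE nth_default // ps; exact: lt.
rewrite big1 ?mul1r => [|i _]; last first.
  by rewrite mxE -[RHS](monicP (pm i)) lead_coefE ps.
by apply: eq_bigr => i _; apply: eq_bigr => j _; rewrite !mxE.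
Qed.

(** Chu-Vandermonde, as concatenation of paths; the bound lets [t] run over all points reachable in
    [m] steps. *)
Lemma binom_diff_conv T m n p q : (p + m < T)%N ->
  \sum_(t < T) binom_diff m p t * binom_diff n t q = binom_diff (m + n) p q.
Proof.
elim: m p => [|m IH] p ltT.
  have ltp : (p < T)%N by lia.
  rewrite (bigD1 (Ordinal ltp)) //= {1}/binom_diff leqnn subnn bin0 mul1r.
  rewrite big1 ?addr0 // => t; rewrite -val_eqE /= => ne.
  by rewrite binom_diff0 ?mul0r // addn0 -eqn_leq eq_sym.
under eq_bigr => t _ do rewrite binom_diffS mulrDl.
by rewrite big_split /= !IH ?addSn ?binom_diffS //; lia.
Qed.

Definition ffact_poly i : {poly rat} := \prod_(t < i) ('X - (t%:R)%:P).

Lemma ffact_polyE i n : (ffact_poly i).[n%:R] = (n ^_ i)%:R.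
Proof.
elim: i => [|i IH]; first by rewrite /ffact_poly big_ord0 hornerC.
rewrite /ffact_poly big_ord_recr hornerM -/(ffact_poly i) IH !hornerE ffactnSr natrM.
have [le|lt] := leqP i n; first by rewrite natrB.
by rewrite ffact_small // !mul0r.
Qed.

Lemma ffact_poly_monic i : ffact_poly i \is monic.
Proof. by apply: monic_prod => t _; apply: monicXsubC. Qed.

Lemma size_ffact_poly i : size (ffact_poly i) = i.+1.
Proof. by rewrite size_prod_XsubC /index_enum -enumT size_enum_ord. Qed.

Lemma fact_neq0 n : (n`!)%:R != 0 :> rat.
Proof. by rewrite pnatr_eq0 -lt0n fact_gt0. Qed.

Lemma ffact_fact_rat n i : (i <= n)%N -> (n ^_ i)%:R = (n`!)%:R / ((n - i)`!)%:R :> rat.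
Proof. by move=> le; rewrite -(ffact_fact le) natrM mulfK ?fact_neq0. Qed.

Lemma bin_rat n m : (m <= n)%N ->
  ('C(n, m))%:R = (n`!)%:R / ((m`!)%:R * ((n - m)`!)%:R) :> rat.
Proof.
move=> le; rewrite -(bin_fact le) !natrM mulfK // mulf_neq0 ?fact_neq0 //.
Qed.

Lemma det_binom_diff n x (A : 'I_x -> nat) : (forall s, A s < n + x)%N ->
  \det (\matrix_(i < x, s < x) binom_diff n i (A s)) =
  (\prod_(i < x) ((n + i)`!)%:R) *
  (\prod_s (((A s)`!)%:R * ((n + x - 1 - A s)`!)%:R)^-1) *
  \prod_(i < x) \prod_(j < x | (i < j)%N) ((A j)%:R - (A i)%:R).
Proof.
move=> Alt.
(* L turns the entries C(n, A s - i) into C(n + x - 1 - i, A s - i), which up to row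
   and column factors is the falling factorial of A s of degree i. *)
pose L : 'M[rat]_x := \matrix_(i, t) binom_diff (x - 1 - i) i t.
have <- : \det (L *m \matrix_(i < x, s < x) binom_diff n i (A s)) =
    \det (\matrix_(i < x, s < x) binom_diff n i (A s)).
  rewrite det_mulmx -det_tr det_trig; last first.
    apply/is_trig_mxP => i j lt; rewrite !mxE binom_diff0 //.
    by rewrite leqNgt lt.
  by rewrite big1 ?mul1r // => i _; rewrite !mxE /binom_diff leqnn subnn bin0.
rewrite -(det_monic (fun s => (A s)%:R) (fun i : 'I_x => ffact_poly_monic i)); last first.
  by move=> i; rewrite size_ffact_poly.
have -> : \prod_(i < x) ((n + i)`!)%:R = \prod_(i < x) ((n + x - 1 - i)`!)%:R :> rat.
  rewrite (reindex_inj rev_ord_inj) /=; apply: eq_bigr => i _.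
  by congr (_`!)%:R; have := ltn_ord i; lia.
rewrite -det_scale; congr (\det _); apply/matrixP => i s; rewrite !mxE.
under eq_bigr => t _ do rewrite !mxE.
have ltix := ltn_ord i; have As := Alt s.
rewrite binom_diff_conv; last lia.
rewrite ffact_polyE /binom_diff; case: leqP => [le|lt]; last first.
  by rewrite ffact_small // mulr0.
rewrite bin_rat ?ffact_fact_rat //; last lia.
have -> : (x - 1 - i + n = n + x - 1 - i)%N by lia.
have -> : (n + x - 1 - i - (A s - i) = n + x - 1 - A s)%N by lia.
by field; rewrite !fact_neq0.
Qed.

(** * Andreief's identity *)

Section Andreief.
Variables (a L : nat) (v w : 'I_L -> rat) (phi psi : 'I_a -> 'I_L -> rat).
Let vdm (f : 'I_a -> 'I_L) : rat := \prod_(i < a) \prod_(j < a | (i < j)%N) (v (f j) - v (f i)).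
Hypothesis det_phi : forall f : 'I_a -> 'I_L, \det (\matrix_(i, j) phi i (f j)) = vdm f.
Hypothesis det_psi : forall f : 'I_a -> 'I_L, \det (\matrix_(i, j) psi i (f j)) = vdm f.

Lemma vdm_perm (f : {ffun 'I_a -> 'I_L}) (s : 'S_a) :
  vdm [ffun i => f (s i)] = (-1) ^+ s * vdm f.
Proof.
rewrite -!det_phi.
rewrite (_ : \matrix_(i, j) _ = col_perm s (\matrix_(i, j) phi i (f j))).
  by rewrite col_permE det_mulmx det_perm odd_permV mulrC.
by apply/matrixP => i j; rewrite !mxE ffunE.
Qed.

(** One of the two Vandermonde factors is expanded as the determinant of [psi]. Relabelling [f] by
    the permutation cancels its sign against that of the other factor, so the [a!] terms agree;
    expanding the other factor by [phi] and distributing gives the determinant of moments. *)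
Lemma andreief_ffun :
  \sum_(f : {ffun 'I_a -> 'I_L}) vdm f ^+ 2 * \prod_j w (f j) =
  (a`!)%:R * \det (\matrix_(i, j) \sum_l w l * phi i l * psi j l).
Proof.
transitivity (\sum_(s : 'S_a) \sum_(f : {ffun 'I_a -> 'I_L})
    vdm f * \prod_j (psi j (f j) * w (f j))).
  transitivity (\sum_(s : 'S_a) \sum_(f : {ffun 'I_a -> 'I_L})
     (-1) ^+ s * vdm f * \prod_j (psi (s j) (f j) * w (f j))).
    rewrite exchange_big /=; apply: eq_bigr => f _.
    have E : vdm f = \sum_(s : 'S_a) (-1) ^+ s * \prod_j psi (s j) (f j).
      rewrite -det_psi -det_tr; apply: eq_bigr => s _; congr (_ * _).
      by apply: eq_bigr => j _; rewrite !mxE.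
    rewrite expr2 {2}E mulr_sumr mulr_suml; apply: eq_bigr => s _.
    by rewrite big_split /= !mulrA; congr (_ * _ * _); rewrite mulrC.
  apply: eq_bigr => s _.
  rewrite (reindex_onto (fun f : {ffun 'I_a -> 'I_L} => [ffun i => f (s i)])
     (fun f => [ffun i => f ((s^-1)%g i)])) /=; last first.
    by move=> f _; apply/ffunP => i; rewrite !ffunE permK.
  apply: eq_big => [f|f _].
    by apply/eqP/ffunP => i; rewrite !ffunE permKV.
  rewrite vdm_perm mulrA -signr_addb addbb mul1r; congr (_ * _).
  rewrite [RHS](reindex_inj (@perm_inj _ s)) /=; apply: eq_bigr => j _.
  by rewrite ffunE.
rewrite sumr_const card_Sn mulr_natl; congr (_ *+ _).
under eq_bigr => f _ do rewrite -det_phi -det_tr mulr_suml.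
rewrite exchange_big -[\det _]det_tr; apply: eq_bigr => s _ /=.
under eq_bigr => f _ do rewrite -mulrA.
rewrite -mulr_sumr; congr (_ * _).
under [RHS]eq_bigr => i _ do rewrite !mxE.
rewrite bigA_distr_bigA /=; apply: eq_bigr => f _.
rewrite -big_split; apply: eq_bigr => i _ /=; rewrite !mxE; ring.
Qed.

(** Listing the points in another order changes only the signs of some differences, which the square
    hides. *)
Lemma vdm_sq (f : {ffun 'I_a -> 'I_L}) : injective f ->
  vdm f ^+ 2 = (\prod_(p in f @: setT) \prod_(q in f @: setT | (p < q)%N) (v q - v p)) ^+ 2.
Proof.
move=> f_inj.
have -> : \prod_(p in f @: setT) \prod_(q in f @: setT | (p < q)%N) (v q - v p) =
  \prod_i \prod_(j | (f i < f j)%N) (v (f j) - v (f i)).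
  rewrite big_imset /=; last by move=> i j _ _; apply: f_inj.
  apply: eq_big => [i|i _]; first by rewrite inE.
  rewrite big_mkcondr big_imset /=; last by move=> i' j _ _; apply: f_inj.
  by rewrite [RHS]big_mkcond; apply: eq_bigl => j; rewrite inE.
rewrite /vdm -!prodrXl.
under eq_bigr do rewrite -prodrXl; under [RHS]eq_bigr do rewrite -prodrXl.
rewrite !pair_big_dep /= (bigID (fun p : 'I_a * 'I_a => f p.1 < f p.2)%N) /=.
rewrite [RHS](bigID (fun p : 'I_a * 'I_a => p.1 < p.2)%N) /=; congr (_ * _).
  by apply: eq_bigl => p; rewrite andbC.
have swap_inj : injective (fun p : 'I_a * 'I_a => (p.2, p.1)) by move=> [? ?] [? ?] [-> ->].
rewrite (reindex_inj swap_inj) /=; apply: eq_big => [[i j]|[i j] _] /=; last first.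
  by rewrite -sqrrN opprB.
have [->|ne] := eqVneq i j; first by rewrite !ltnn.
have := inj_eq f_inj i j; rewrite (negPf ne) => /negbT; move: ne.
rewrite -!val_eqE /=; lia.
Qed.

Lemma card_ffun_image (B : {set 'I_L}) : #|B| = a ->
  #|[set f : {ffun 'I_a -> 'I_L} | injectiveb f & f @: setT == B]| = a`!.
Proof.
move=> cB; transitivity #|[set f : {ffun 'I_a -> 'I_L} in ffun_on (mem B) | injectiveb f]|.
  apply: eq_card => f; rewrite !inE andbC; case: injectiveP => f_inj; rewrite ?andbF ?andbT //.
  apply/eqP/ffun_onP => [<- i|fB]; first by rewrite imset_f.
  apply/eqP; rewrite eqEcard card_imset // cardsT card_ord cB leqnn andbT.
  by apply/subsetP => _ /imsetP[i _ ->].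
by rewrite card_inj_ffuns_on card_ord cB ffactnn.
Qed.

(** In the sum over functions, a function that is not injective has a zero Vandermonde product, and
    each set is the image of [a!] injective ones. *)
Theorem andreief :
  \sum_(B : {set 'I_L} | #|B| == a)
     (\prod_(p in B) \prod_(q in B | (p < q)%N) (v q - v p)) ^+ 2 * \prod_(p in B) w p =
  \det (\matrix_(i, j) \sum_l w l * phi i l * psi j l).
Proof.
apply: (mulfI (fact_neq0 a)); rewrite -andreief_ffun mulr_sumr.
rewrite [RHS](bigID (fun f : {ffun _} => injectiveb f)) /= [X in _ + X]big1 ?addr0; last first.
  move=> f /injectivePn[i [j ij fij]].
  suff -> : vdm f = 0 by rewrite expr0n mul0r.
  rewrite -det_phi -det_tr; apply: (determinant_alternate ij) => l.
  by rewrite !mxE fij.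
rewrite [RHS](partition_big (fun f : {ffun _} => f @: setT) (fun B : {set 'I_L} => #|B| == a)) /=.
  apply: eq_bigr => B /eqP cB; rewrite mulr_natl -(card_ffun_image cB) -sumr_const.
  apply: eq_big => [f|f]; rewrite inE // => /andP[/injectiveP f_inj /eqP <-].
  rewrite vdm_sq //; congr (_ * _).
  rewrite big_imset /=; last by move=> ? ? _ _; apply: f_inj.
  by apply: eq_bigl => i; rewrite inE.
by move=> f /injectiveP f_inj; rewrite card_imset // cardsT card_ord.
Qed.
End Andreief.

(** * Evaluation of the sum *)

Ltac nat_ne0 :=
  do 4?rewrite ?(nat1r, natr1, =^~ natrD); rewrite ?fact_neq0 ?pnatr_eq0 ?addSn //=.

(* The contribution of the pair of end points o - 1 - k - l and o + k + l to the
   factorial denominators is half_weight k p l * half_weight k q l. *)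
Definition half_weight k p l : rat :=
  if (l <= p)%N then (((p - l)`!)%:R * ((p + k.*2.+1 + l)`!)%:R)^-1 else 0.

Lemma half_weight_lower k p l :
  half_weight k p l =
  (p.+1%:R - l%:R) * (p + k.*2.+2 + l)%:R * half_weight k p.+1 l.
Proof.
rewrite /half_weight; case: (ltngtP l p.+1) => [|lt|->]; last 2 first.
- by rewrite leqNgt ltnW ?mulr0.
- by rewrite ltnn subrr !mul0r.
rewrite ltnS => le; rewrite le subSn // addSn addSn factS [in X in _ = _ * X]factS !natrM.
rewrite -natrB ?leqW // subSn //.
have -> : (p + k.*2.+2 + l = (p + k.*2.+1 + l).+1)%N by lia.
by field; nat_ne0.
Qed.

Lemma half_weight_shift k p l :
  (p + k.*2.+2 + l)%:R * half_weight k p l.+1 = (p%:R - l%:R) * half_weight k p l.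
Proof.
rewrite /half_weight; case: (ltngtP l p) => [lt|lt|->]; last 2 first.
- by rewrite !mulr0.
- by rewrite subrr !mul0r mulr0.
rewrite -natrB; last exact: ltnW.
have -> : (p + k.*2.+2 + l = (p + k.*2.+1 + l).+1)%N by lia.
have -> : (p + k.*2.+1 + l.+1 = (p + k.*2.+1 + l).+1)%N by lia.
rewrite -(subnSK lt) !factS !natrM.
by field; nat_ne0.
Qed.

(** For the pair of points [o - 1 - k - l] and [o + k + l], the factor [2k + 1 + 2l] is their
    difference, and the quotient of factorials collects their differences with the [k] points of the
    middle block. *)
Definition weight k p q l : rat :=
  (k.*2.+1 + l.*2)%:R * ((k.*2 + l)`!)%:R / (l`!)%:R *
  half_weight k p l * half_weight k q l.

Definition weight_total k p q : rat :=
  (k`!)%:R * ((p + q + k)`!)%:R /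
  (((p + q + k.*2.+1)`!)%:R * ((p + k)`!)%:R * ((q + k)`!)%:R * (p`!)%:R * (q`!)%:R).

(* WZ certificate of the summation of weight k p q l over l. *)
Definition weight_cert k p q l : rat :=
  (k + l)%:R * l%:R * ((k.*2 + l)`!)%:R / (l`!)%:R *
  (p + k.*2.+1 + l)%:R * (q + k.*2.+2 + l)%:R * half_weight k p l * half_weight k q.+1 l.

Lemma weight_certP k p q l :
  (p + q + k.*2.+2)%:R * (q + k.+1)%:R * (q.+1)%:R * weight k p q.+1 l -
  (p + q + k.+1)%:R * weight k p q l =
  weight_cert k p q l - weight_cert k p q l.+1.
Proof.
have Ep := half_weight_shift k p l.
have Eq := half_weight_shift k q.+1 l.
rewrite /weight [half_weight k q l]half_weight_lower /weight_cert.
set P := half_weight k p l in Ep *; set U := half_weight k q.+1 l in Eq *.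
set P' := half_weight k p l.+1 in Ep *; set U' := half_weight k q.+1 l.+1 in Eq *.
(* The certificate at [l + 1] is written so that each shifted half weight carries exactly the factor
   of [half_weight_shift]. Afterwards only [P] and [U] remain and the identity is rational. *)
have -> : (k + l.+1)%:R * l.+1%:R * ((k.*2 + l.+1)`!)%:R / ((l.+1)`!)%:R *
  (p + k.*2.+1 + l.+1)%:R * (q + k.*2.+2 + l.+1)%:R * P' * U' =
  (k + l.+1)%:R * (k.*2 + l.+1)%:R * ((k.*2 + l)`!)%:R / (l`!)%:R *
  ((p + k.*2.+2 + l)%:R * P') * ((q.+1 + k.*2.+2 + l)%:R * U') :> rat.
  rewrite !addnS !addSn !factS !natrM; by field; nat_ne0.
rewrite Ep Eq -[k.*2]addnn -[l.*2]addnn.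
by field; nat_ne0.
Qed.

(** Induction on [q]: for [q = 0] only [l = 0] contributes, and the certificate shows that both
    sides satisfy the same first-order recurrence. *)
Lemma sum_weight k p q T : (p < T)%N ->
  \sum_(l < T) weight k p q l = weight_total k p q.
Proof.
move=> ltpT; elim: q => [|q IH].
  case: T ltpT => // T _.
  rewrite big_ord_recl big1 ?addr0 => [|i _]; last first.
    by rewrite /weight /half_weight !ltn0 mulr0.
  rewrite /weight /weight_total /half_weight /= !addn0 !add0n !subn0 fact0.
  rewrite [(k.*2.+1)`!]factS natrM.
  by field; nat_ne0.
have nz : (p + q + k.*2.+2)%:R * (q + k.+1)%:R * (q.+1)%:R != 0 :> rat.
  by rewrite !mulf_neq0 // pnatr_eq0 // !addnS.
apply: (mulfI nz).
have : \sum_(l < T) ((p + q + k.*2.+2)%:R * (q + k.+1)%:R * (q.+1)%:R * weight k p q.+1 l -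
  (p + q + k.+1)%:R * weight k p q l) = 0.
  under eq_bigr do rewrite weight_certP.
  rewrite -(big_mkord xpredT (fun l => weight_cert k p q l - weight_cert k p q l.+1)).
  rewrite -[LHS]opprK -sumrN.
  under eq_bigr do rewrite opprB.
  (* The certificate vanishes at 0 by its factor [l], and at [T] because [p < T] cuts the half
     weight off. *)
  rewrite telescope_sumr // /weight_cert /half_weight leqNgt ltpT !(mulr0, mul0r).
  by rewrite subrr oppr0.
rewrite sumrB -!mulr_sumr IH => /eqP; rewrite subr_eq0 => /eqP ->.
rewrite /weight_total.
have -> : (p + q.+1 + k = (p + q + k).+1)%N by lia.
have -> : (p + q.+1 + k.*2.+1 = (p + q + k.*2.+1).+1)%N by lia.
have -> : (p + q + k.*2.+2 = (p + q + k.*2.+1).+1)%N by lia.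
rewrite addSn !addnS !factS !natrM.
by field; nat_ne0.
Qed.

Lemma weightC k p q l : weight k p q l = weight k q p l.
Proof. by rewrite /weight mulrAC. Qed.

Lemma weight_totalC k p q : weight_total k p q = weight_total k q p.
Proof. by rewrite /weight_total [(q + p)%N]addnC; field; rewrite !fact_neq0. Qed.

Lemma sum_weight_min k p q T : (p < T)%N || (q < T)%N ->
  \sum_(l < T) weight k p q l = weight_total k p q.
Proof.
case/orP => lt; first exact: sum_weight.
rewrite weight_totalC -(sum_weight k p lt); apply: eq_bigr => l _; exact: weightC.
Qed.

(* As polynomials in - l (l + 2 k + 1), so that the degree is i. *)
Definition shift_poly k p i : {poly rat} :=
  \prod_(t < i) ('X - (- ((p%:R - t%:R) * (p%:R - t%:R + k.*2.+1%:R)))%:P).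

Lemma shift_poly_monic k p i : shift_poly k p i \is monic.
Proof. by apply: monic_prod => t _; apply: monicXsubC. Qed.

Lemma size_shift_poly k p i : size (shift_poly k p i) = i.+1.
Proof. by rewrite size_prod_XsubC /index_enum -enumT size_enum_ord. Qed.

(** Multiplying a half weight by such a polynomial only lowers its parameter. With these polynomials
    as test functions, every moment in Andreief's identity is a total weight at shifted
    parameters. *)
Lemma shift_polyE k p i l : (i <= p)%N ->
  half_weight k (p - i) l =
  (shift_poly k p i).[- (l%:R * (l%:R + k.*2.+1%:R))] * half_weight k p l.
Proof.
elim: i => [|i IH] le; first by rewrite subn0 /shift_poly big_ord0 hornerC mul1r.
rewrite half_weight_lower.
have -> : ((p - i.+1).+1 = p - i)%N by lia.
rewrite IH ?(ltnW le) // /shift_poly big_ord_recr /= hornerM hornerXsubC -/(shift_poly k p i).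
have -> : (p - i.+1 + k.*2.+2 + l)%:R = p%:R - i%:R + k.*2.+1%:R + l%:R :> rat.
  rewrite -natrB; last lia.
  by rewrite -!natrD; congr _%:R; lia.
rewrite natrB; [ring | lia].
Qed.

(** The summand is the beta integral of [t^s (1 - t)^(k + r) / k!] over the unit interval; the
    formula expands [t^i] as the power of [1 - (1 - t)], by iterating the difference equation
    [gS]. *)
Lemma hankel_diff k s r i :
  ((k + r)`!)%:R / (k`!)%:R * ((s + i)`!)%:R / ((s + i + k.+1 + r)`!)%:R =
  \sum_(l < i.+1) (-1) ^+ l * ('C(i, l))%:R *
    (((k + (r + l))`!)%:R / (k`!)%:R * (s`!)%:R / ((s + k.+1 + (r + l))`!)%:R) :> rat.
Proof.
pose g r s : rat := ((k + r)`!)%:R / (k`!)%:R * (s`!)%:R / ((s + k.+1 + r)`!)%:R.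
have gS r' s' : g r' s'.+1 = g r' s' - g r'.+1 s'.
  rewrite /g !addSn !addnS !addSn !factS !natrM.
  by field; nat_ne0.
suff : g r (s + i)%N = \sum_(l < i.+1) (-1) ^+ l * ('C(i, l))%:R * g (r + l)%N s by [].
elim: i r => [|i IH] r; first by rewrite big_ord1 bin0 !addn0 !mul1r.
rewrite addnS gS !IH [RHS]big_ord_recl /= bin0 expr0 !mul1r addn0.
under [X in _ = _ + X]eq_bigr => l _ do rewrite /bump /= add1n binS natrD mulrDr mulrDl.
rewrite big_split /= big_ord_recl bin0 expr0 !mul1r addn0 -!addrA; congr (_ + _).
rewrite -sumrN; congr (_ + _).
  rewrite [RHS]big_ord_recr /= bin_small // mulr0 mul0r addr0.
  by apply: eq_bigr => l _; rewrite /bump /= add1n.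
apply: eq_bigr => l _; rewrite exprS addnS addSn; ring.
Qed.

Lemma prod_sub_ord n :
  \prod_(i < n) (-1) ^+ i * \prod_(i < n) \prod_(j < n | (i < j)%N) (i%:R - j%:R) =
  \prod_(i < n) (i`!)%:R :> rat.
Proof.
under [X in _ * X]eq_bigr => i _ do rewrite big_mkcond.
rewrite exchange_big -big_split /=; apply: eq_bigr => j _.
rewrite -big_mkcond /= (_ : \prod_(i < n | (i < j)%N) (i%:R - j%:R) =
  \prod_(0 <= i < j) (i%:R - j%:R) :> rat); last first.
  by rewrite (big_nat_widen _ _ n) ?(ltnW (ltn_ord j)) // big_mkord.
rewrite fact_prod natr_prod big_add1 /= big_nat_rev /= add0n.
rewrite -[X in (-1) ^+ X](subn0 j) -prodr_const_nat -big_split /= !big_mkord.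
apply: eq_bigr => i _; have := ltn_ord i => lt.
by rewrite natrB; [ring|lia].
Qed.

(** By [hankel_diff] the matrix is a triangular one, with diagonal signs, times the matrix of
    [g i (n + j)]. With both index orders reversed, the latter becomes, up to row and column
    factors, the falling factorials of degree [i] at the nodes [v j]. *)
Lemma det_hankel n k a :
  \det (\matrix_(i < a, j < a) (((n + i + j)`!)%:R / ((n + i + j + k.+1)`!)%:R)) =
  \prod_(i < a) ((i`!)%:R * ((k + i)`!)%:R / (k`!)%:R * ((n + i)`!)%:R /
                  ((n + k + a + i)`!)%:R) :> rat.
Proof.
pose g r s : rat := ((k + r)`!)%:R / (k`!)%:R * (s`!)%:R / ((s + k.+1 + r)`!)%:R.
pose T : 'M[rat]_a := \matrix_(i, l) ((-1) ^+ l * ('C(i, l))%:R).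
have -> : \matrix_(i < a, j < a) (((n + i + j)`!)%:R / ((n + i + j + k.+1)`!)%:R) =
   T *m \matrix_(i < a, j < a) g i (n + j)%N :> 'M[rat]_a.
  apply/matrixP => i j; rewrite !mxE.
  under eq_bigr => l _ do rewrite !mxE.
  have := hankel_diff k (n + j) 0 i; rewrite !addn0 divff ?fact_neq0 // mul1r addnAC => ->.
  rewrite (big_ord_widen a (fun l => (-1) ^+ l * ('C(i, l))%:R *
    (((k + (0 + l))`!)%:R / (k`!)%:R * ((n + j)`!)%:R / ((n + j + k.+1 + (0 + l))`!)%:R))) //.
  rewrite big_mkcond; apply: eq_bigr => l _; case: ltnP => // lt.
  by rewrite bin_small // mulr0 mul0r.
rewrite det_mulmx det_trig; last first.
  by apply/is_trig_mxP => i j lt; rewrite mxE bin_small // mulr0.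
have -> : \prod_(i < a) T i i = \prod_(i < a) (-1) ^+ i.
  by apply: eq_bigr => i _; rewrite mxE binn mulr1.
rewrite -det_rev.
pose v (j : 'I_a) : rat := (n + k + a + rev_ord j)%:R.
have -> : \matrix_(i, j) (\matrix_(i0 < a, j0 < a) g i0 (n + j0)%N) (rev_ord i) (rev_ord j) =
  \matrix_(i < a, j < a) (((k + rev_ord i)`!)%:R / (k`!)%:R *
    (((n + rev_ord j)`!)%:R / ((n + k + a + rev_ord j)`!)%:R) * (ffact_poly i).[v j]).
  apply/matrixP => i j; rewrite !mxE /v ffact_polyE ffact_fact_rat; last first.
    have := ltn_ord i; lia.
  rewrite /g (_ : (n + k + a + rev_ord j - i = n + rev_ord j + k.+1 + rev_ord i)%N); last first.
    by have := ltn_ord i => /=; lia.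
  by field; nat_ne0.
rewrite (det_scale (fun i : 'I_a => ((k + rev_ord i)`!)%:R / (k`!)%:R)
  (fun j : 'I_a => ((n + rev_ord j)`!)%:R / ((n + k + a + rev_ord j)`!)%:R)
  (fun i j => (ffact_poly i).[v j])) (det_monic v (fun i : 'I_a => ffact_poly_monic i)); last first.
  by move=> i; rewrite size_ffact_poly.
under [X in _ * (_ * X)]eq_bigr => i _.
  under eq_bigr => j _.
    have -> : v j - v i = i%:R - j%:R.
      have ltj := ltn_ord j; have lti := ltn_ord i.
      rewrite /v /= -[X in X - _]addr0 !natrD !natrB // -!natr1; ring.
    over.
  over.
rewrite mulrCA prod_sub_ord.
rewrite (prod_rev_ord _ (fun i => ((k + i)`!)%:R / (k`!)%:R)).
rewrite (prod_rev_ord _ (fun j => ((n + j)`!)%:R / ((n + k + a + j)`!)%:R)).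
by rewrite -!big_split /=; apply: eq_bigr => i _; field; nat_ne0.
Qed.

(** Andreief's identity, where [phi] lowers the parameter from [a + c - 1] and [psi] the one from
    [a + b - 1]. After reversal of the indices, the total weights are row and column factors times
    the entries of [det_hankel] for [n = b + c + k]. *)
Lemma sum_weight_vdm a b c k L : L = minn (a + b) (a + c) ->
  \sum_(B : {set 'I_L} | #|B| == a)
     (\prod_(l in B) \prod_(m in B | (l < m)%N) ((m%:R - l%:R) * (l + m + k.*2.+1)%:R)) ^+ 2 *
     \prod_(l in B) weight k (a + c).-1 (a + b).-1 l =
  \prod_(i < a) ((i`!)%:R * ((k + i)`!)%:R * ((b + c + k + i)`!)%:R /
     (((c + i + k)`!)%:R * ((b + i + k)`!)%:R * ((c + i)`!)%:R * ((b + i)`!)%:R *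
      ((b + c + k + k + a + i)`!)%:R)).
Proof.
move=> LE; pose v (l : 'I_L) : rat := - (l%:R * (l%:R + k.*2.+1%:R)).
pose phi (p : nat) (i : 'I_a) l := (shift_poly k p i).[v l].
have det_phi p (f : 'I_a -> 'I_L) : \det (\matrix_(i, j) phi p i (f j)) =
    \prod_(i < a) \prod_(j < a | (i < j)%N) (v (f j) - v (f i)).
  rewrite -(det_monic (v \o f) (fun i : 'I_a => shift_poly_monic k p i)) //.
  by move=> i; rewrite size_shift_poly.
have := andreief (fun l : 'I_L => weight k (a + c).-1 (a + b).-1 l)
  (det_phi (a + c).-1) (det_phi (a + b).-1).
set W := \matrix_(i, j) _; move=> E.
transitivity (\det W).
  rewrite -E; apply: eq_bigr => B _; congr (_ * _).
  rewrite -!prodrXl; apply: eq_bigr => l _; rewrite -!prodrXl; apply: eq_bigr => m _.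
  by rewrite /v !natrD; ring.
have {E} -> : W = \matrix_(i, j) weight_total k ((a + c).-1 - i) ((a + b).-1 - j).
  apply/matrixP => i j; rewrite !mxE; have lti := ltn_ord i; have ltj := ltn_ord j.
  (* [L] is the smaller of the two bounds, so at least one of the two half weights vanishes from [L]
     on. *)
  rewrite -(@sum_weight_min _ _ _ L); last by rewrite LE; lia.
  apply: eq_bigr => l _; rewrite /weight /phi /v !shift_polyE; try lia.
  ring.
rewrite -det_rev.
have -> : \matrix_(i, j) (\matrix_(i0, j0)
     weight_total k ((a + c).-1 - i0) ((a + b).-1 - j0)) (rev_ord i) (rev_ord j) =
  \matrix_(i < a, j < a) ((k`!)%:R / (((c + i + k)`!)%:R * ((c + i)`!)%:R) *
    (((b + j + k)`!)%:R * ((b + j)`!)%:R)^-1 *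
    (((b + c + k + i + j)`!)%:R / ((b + c + k + i + j + k.+1)`!)%:R)) :> 'M[rat]_a.
  apply/matrixP => i j; rewrite !mxE /weight_total /=; have lti := ltn_ord i; have ltj := ltn_ord j.
  have -> : ((a + c).-1 - (a - i.+1) = c + i)%N by lia.
  have -> : ((a + b).-1 - (a - j.+1) = b + j)%N by lia.
  have -> : (c + i + (b + j) + k = b + c + k + i + j)%N by lia.
  have -> : (c + i + (b + j) + k.*2.+1 = b + c + k + i + j + k.+1)%N by lia.
  by field; nat_ne0.
rewrite (det_scale (fun i : 'I_a => (k`!)%:R / (((c + i + k)`!)%:R * ((c + i)`!)%:R))
  (fun j : 'I_a => (((b + j + k)`!)%:R * ((b + j)`!)%:R)^-1)
  (fun i j => ((b + c + k + i + j)`!)%:R / ((b + c + k + i + j + k.+1)`!)%:R)).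
rewrite det_hankel -!big_split /=; apply: eq_bigr => i _.
by field; nat_ne0.
Qed.

(** * Vandermonde products of symmetric sets of points *)

Definition vdm_seq (s : seq nat) : rat :=
  \prod_(p <- s) \prod_(q <- s | (p < q)%N) (q%:R - p%:R).

(** Pairs are selected by comparing values and not positions, so the order of the list is
    irrelevant. This allows a sorted set to be replaced by its three blocks. *)
Lemma vdm_seq_perm s t : perm_eq s t -> vdm_seq s = vdm_seq t.
Proof.
by move=> st; rewrite /vdm_seq (perm_big _ st); apply: eq_bigr => p _; apply: perm_big.
Qed.

Lemma vdm_seq_sorted s x : sorted ltn s -> size s = x ->
  \prod_(i < x) \prod_(j < x | (i < j)%N) ((nth 0 s j)%:R - (nth 0 s i)%:R) = vdm_seq s.
Proof.
move=> ss <-; rewrite /vdm_seq (big_nth 0%N) big_mkord; apply: eq_bigr => i _.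
rewrite (big_nth 0%N) big_mkord; apply: eq_bigl => j.
have mono := sorted_ltn_nth ltn_trans 0%N ss.
case: (ltngtP i j) => [lt|lt|->]; last by rewrite ltnn.
- by apply/esym; apply: mono => //; rewrite inE.
- by apply/esym/negbTE; rewrite -leqNgt ltnW //; apply: mono => //; rewrite inE.
Qed.

Lemma vdm_seq_cat s t : {in s & t, forall p q, (p < q)%N} ->
  vdm_seq (s ++ t) = vdm_seq s * vdm_seq t * \prod_(p <- s) \prod_(q <- t) (q%:R - p%:R).
Proof.
move=> lt; rewrite /vdm_seq big_cat /= [RHS]mulrAC; congr (_ * _).
  rewrite -big_split /=; apply: eq_big_seq => p ps; rewrite big_cat; congr (_ * _).
  by rewrite big_seq_cond [RHS]big_seq; apply: eq_bigl => q; case qt: (q \in t); rewrite //= lt.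
apply: eq_big_seq => p pt; rewrite big_cat /= big_seq_cond big1 ?mul1r // => q /andP[qs].
by rewrite ltnNge ltnW // lt.
Qed.

Lemma vdm_seq_iota n k : vdm_seq (iota n k) = \prod_(i < k) (i`!)%:R.
Proof.
elim: k => [|k IH]; first by rewrite /vdm_seq big_nil big_ord0.
rewrite -[k.+1]addn1 iotaD vdm_seq_cat; last first.
  by move=> p q; rewrite mem_iota inE => /andP[_ +] /eqP ->.
have -> : vdm_seq (iota (n + k) 1) = 1.
  by rewrite /vdm_seq /= big_seq1 big_cons big_nil ltnn.
rewrite IH mulr1 addn1 big_ord_recr /=; congr (_ * _).
under eq_bigr do rewrite big_seq1.
rewrite -{1}[n]addn0 iotaDl big_map -[k in iota _ k]subn0 -/(index_iota 0 k).
rewrite big_mkord fact_prod natr_prod big_add1 big_mkord (reindex_inj rev_ord_inj).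
by apply: eq_bigr => i _ /=; have lt := ltn_ord i; rewrite -natrB; [congr _%:R; lia|lia].
Qed.

Lemma prod_swap (t : seq nat) (G : nat -> nat -> rat) :
  \prod_(l <- t) \prod_(m <- t | (m < l)%N) G l m =
  \prod_(l <- t) \prod_(m <- t | (l < m)%N) G m l.
Proof.
under eq_bigr do rewrite big_mkcond.
by rewrite exchange_big; apply: eq_bigr => l _; rewrite -big_mkcond.
Qed.

Lemma prod_diag (t : seq nat) (G : nat -> nat -> rat) : uniq t ->
    (forall l m, G l m = G m l) ->
  \prod_(l <- t) \prod_(m <- t) G l m =
  (\prod_(l <- t) \prod_(m <- t | (l < m)%N) G l m) ^+ 2 * \prod_(l <- t) G l l.
Proof.
move=> ut Gs; rewrite expr2.
have E : \prod_(l <- t) \prod_(m <- t | (l < m)%N) G l m =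
    \prod_(l <- t) \prod_(m <- t | (m < l)%N) G l m.
  by rewrite prod_swap; apply: eq_bigr => l _; apply: eq_bigr => m _.
rewrite {2}E -!big_split; apply: eq_big_seq => l lt /=.
rewrite (bigID (fun m => l < m)%N) /= -mulrA; congr (_ * _).
rewrite (bigID (fun m => m < l)%N) /=; congr (_ * _).
  by apply: eq_bigl => m; case: ltngtP.
rewrite -(big_filter _ (fun m => ~~ (l < m) && ~~ (m < l))%N).
rewrite (@eq_filter _ _ (pred1 l)); last by move=> m /=; case: ltngtP.
by rewrite filter_pred1_uniq // big_seq1.
Qed.

(** Inside each outer block the differences are [m - l]. Between the outer blocks they are
    [l + m + 2k + 1], over all ordered pairs, whence a square and a diagonal factor. The differences
    of an outer point with the middle block form a falling factorial ([X1] and [X2]). *)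
Lemma vdm_seq_mirror o k (t : seq nat) : uniq t -> all (fun l => k + l < o)%N t ->
  vdm_seq (map (fun l => o.-1 - k - l)%N t ++ iota (o - k) k ++ map (addn (o + k)) t) =
  (\prod_(i < k) (i`!)%:R) *
  ((\prod_(l <- t) \prod_(m <- t | (l < m)%N) ((m%:R - l%:R) * (l + m + k.*2.+1)%:R)) ^+ 2 *
  \prod_(l <- t) ((k.*2.+1 + l.*2)%:R * ((k.*2 + l)`!)%:R / (l`!)%:R)).
Proof.
move=> ut /allP tlt.
have V1 : vdm_seq (map (fun l => o.-1 - k - l)%N t) =
    \prod_(l <- t) \prod_(m <- t | (l < m)%N) (m%:R - l%:R).
  rewrite /vdm_seq big_map -prod_swap; apply: eq_big_seq => l /tlt lo.
  rewrite big_map big_seq_cond [RHS]big_seq_cond; apply: eq_big => m.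
    by case mt: (m \in t) => //=; have := tlt _ mt; lia.
  by move=> /andP[/tlt mo _]; rewrite !natrB; try lia; ring.
have V3 : vdm_seq (map (addn (o + k)) t) =
    \prod_(l <- t) \prod_(m <- t | (l < m)%N) (m%:R - l%:R).
  rewrite /vdm_seq big_map; apply: eq_bigr => l _; rewrite big_map.
  apply: eq_big => m; first by rewrite ltn_add2l.
  by rewrite !natrD => _; ring.
rewrite vdm_seq_cat; last first.
  move=> p q /mapP[l /tlt lo ->]; rewrite mem_cat => /orP[|/mapP[m _ ->]].
    by rewrite mem_iota; lia.
  lia.
rewrite (@vdm_seq_cat (iota _ _)); last first.
  by move=> p q; rewrite mem_iota => pk /mapP[m /tlt mo ->]; lia.
rewrite V1 V3 vdm_seq_iota big_map.
have X1 : \prod_(l <- t) \prod_(q <- iota (o - k) k ++ map (addn (o + k)) t)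
     (q%:R - (o.-1 - k - l)%:R) =
   \prod_(l <- t) (((l + k)`!)%:R / (l`!)%:R) * \prod_(l <- t) \prod_(m <- t) (l + m + k.*2.+1)%:R :> rat.
  rewrite -big_split /=; apply: eq_big_seq => l /tlt lo; rewrite big_cat /=; congr (_ * _).
    have -> : ((l + k)`!)%:R / (l`!)%:R = ((l + k) ^_ k)%:R :> rat.
      by rewrite ffact_fact_rat ?leq_addl // addnK.
    rewrite -{1}[(o - k)%N]addn0 iotaDl big_map -[k in iota _ k]subn0 -/(index_iota 0 k).
    rewrite big_mkord ffact_prod natr_prod (reindex_inj rev_ord_inj).
    by apply: eq_bigr => i _ /=; have lt := ltn_ord i; rewrite -natrB; [congr _%:R; lia|lia].
  rewrite big_map; apply: eq_bigr => m _.
  by rewrite -natrB; [congr _%:R; lia|lia].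
have X2 : \prod_(p <- iota (o - k) k) \prod_(q <- map (addn (o + k)) t) (q%:R - p%:R) =
   \prod_(l <- t) (((k.*2 + l)`!)%:R / ((l + k)`!)%:R) :> rat.
  rewrite exchange_big big_map; apply: eq_big_seq => l /tlt lo.
  have -> : ((k.*2 + l)`!)%:R / ((l + k)`!)%:R = ((k.*2 + l) ^_ k)%:R :> rat.
    by rewrite ffact_fact_rat; [congr (_ / (_`!)%:R); lia | lia].
  rewrite -{1}[(o - k)%N]addn0 iotaDl big_map -[k in iota _ k]subn0 -/(index_iota 0 k).
  rewrite big_mkord ffact_prod natr_prod.
  by apply: eq_bigr => i _ /=; have lt := ltn_ord i; rewrite -natrB; [congr _%:R; lia|lia].
rewrite X1 X2 prod_diag //; last by move=> l m; rewrite [(m + l)%N]addnC.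
under [in RHS]eq_bigr do rewrite big_split.
rewrite [in RHS]big_split /=.
have -> : \prod_(l <- t) ((k.*2.+1 + l.*2)%:R * ((k.*2 + l)`!)%:R / (l`!)%:R) =
  \prod_(l <- t) (((k.*2 + l)`!)%:R / ((l + k)`!)%:R) *
  \prod_(l <- t) (((l + k)`!)%:R / (l`!)%:R) * \prod_(l <- t) (l + l + k.*2.+1)%:R :> rat.
  rewrite -!big_split /=; apply: eq_bigr => l _.
  rewrite (_ : k.*2.+1 + l.*2 = l + l + k.*2.+1)%N; last lia.
  by field; nat_ne0.
ring.
Qed.

(* The end points of a symmetric tiling: t lists the distances to the block of
   the end points to its right, o being the abscissa of the center. *)
Definition mirror o k (t : seq nat) : seq nat :=
  (map (fun l => o.-1 - k - l) t ++ iota (o - k) k ++ map (addn (o + k)) t)%N.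

(** In [det_binom_diff], the two mirror points of index [l] contribute four factorials, which
    regroup crosswise into one half weight for [a + c - 1] and one for [a + b - 1]. *)
Lemma det_mirror a b c k (t A : seq nat) :
    sorted ltn A -> perm_eq A (mirror (a + c + k) k t) -> uniq t -> size t = a ->
    all (fun l => (l < a + b) && (l < a + c))%N t ->
  \det (\matrix_(i < a.*2 + k, s < a.*2 + k) binom_diff (b + c + k) i (nth 0%N A s)) =
  (\prod_(i < a.*2 + k) ((b + c + k + i)`!)%:R) *
  (\prod_(i < k) ((i`!)%:R / (((a + c + i)`!)%:R * ((a + b + k + i)`!)%:R))) *
  ((\prod_(l <- t) \prod_(m <- t | (l < m)%N) ((m%:R - l%:R) * (l + m + k.*2.+1)%:R)) ^+ 2 *
   \prod_(l <- t) weight k (a + c).-1 (a + b).-1 l).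
Proof.
move=> sA pA ut st /allP tlt.
have szA : size A = (a.*2 + k)%N.
  by rewrite (perm_size pA) /mirror !size_cat !size_map size_iota st; lia.
rewrite (det_binom_diff (A := fun s => nth 0%N A s)); last first.
  move=> s; have : nth 0%N A s \in A by apply: mem_nth; rewrite szA.
  rewrite (perm_mem pA) /mirror !mem_cat => /or3P[/mapP[l /tlt lt ->]| |/mapP[l /tlt lt ->]].
  - lia.
  - rewrite mem_iota; lia.
  - lia.
rewrite (vdm_seq_sorted sA szA) (vdm_seq_perm pA) vdm_seq_mirror //; last first.
  by apply/allP => l /tlt; lia.
set g := fun p : nat => ((p`!)%:R * ((b + c + k + (a.*2 + k) - 1 - p)`!)%:R)^-1 : rat.
have -> : \prod_(s < a.*2 + k) g (nth 0%N A s) =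
   (\prod_(l <- t) (half_weight k (a + c).-1 l * half_weight k (a + b).-1 l)) *
   \prod_(i < k) (((a + c + i)`!)%:R * ((a + b + k + i)`!)%:R)^-1.
  rewrite -szA -(big_mkord xpredT (fun s => g (nth 0%N A s))) -(big_nth 0%N xpredT g).
  rewrite (perm_big _ pA) /mirror !big_cat !big_map /= mulrCA mulrC; congr (_ * _).
    rewrite -big_split /=; apply: eq_big_seq => l /tlt lt.
    rewrite /g /half_weight !ifT; try lia.
    have -> : ((a + c + k).-1 - k - l = (a + c).-1 - l)%N by lia.
    have -> : (b + c + k + (a.*2 + k) - 1 - ((a + c).-1 - l) = (a + b).-1 + k.*2.+1 + l)%N by lia.
    have -> : (a + c + k + k + l = (a + c).-1 + k.*2.+1 + l)%N by lia.
    have -> : (b + c + k + (a.*2 + k) - 1 - ((a + c).-1 + k.*2.+1 + l) = (a + b).-1 - l)%N by lia.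
    by field; nat_ne0.
  rewrite addnK -{1}[(a + c)%N]addn0 iotaDl big_map -[k in iota _ k]subn0 -/(index_iota 0 k).
  rewrite big_mkord /g.
  have -> : \prod_(i < k) (((a + c + i)`!)%:R * ((b + c + k + (a.*2 + k) - 1 - (a + c + i))`!)%:R)^-1 =
    \prod_(i < k) (((a + c + i)`!)%:R)^-1 * \prod_(i < k) ((a + b + k + rev_ord i)`!)%:R^-1 :> rat.
    rewrite -big_split; apply: eq_bigr => i _ /=; rewrite invfM; congr (_ * (_`!)%:R^-1).
    by have := ltn_ord i; lia.
  rewrite (prod_rev_ord _ (fun i => ((a + b + k + i)`!)%:R^-1)) -big_split /=.
  by apply: eq_bigr => i _; rewrite invfM.
rewrite [X in _ = _ * X * _]big_split [in RHS]mulrA.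
have -> : \prod_(l <- t) weight k (a + c).-1 (a + b).-1 l =
  \prod_(l <- t) ((k.*2.+1 + l.*2)%:R * ((k.*2 + l)`!)%:R / (l`!)%:R) *
  \prod_(l <- t) (half_weight k (a + c).-1 l * half_weight k (a + b).-1 l).
  by rewrite -big_split /=; apply: eq_bigr => l _; rewrite /weight mulrA.
rewrite /=; ring.
Qed.

(** * Superfactorials and MacMahon's product *)

Definition superfact n : rat := \prod_(i < n) (i`!)%:R.

Lemma superfact_neq0 n : superfact n != 0.
Proof. by apply/prodf_neq0 => i _; apply: fact_neq0. Qed.

Lemma prod_fact_shift s n :
  \prod_(i < n) ((s + i)`!)%:R = superfact (s + n) / superfact s.
Proof.
rewrite /superfact big_split_ord /= mulrAC divff ?mul1r //; exact: superfact_neq0.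
Qed.

Lemma pochhammer_fact n k :
  pochhammer n.+1%:R k = ((n + k)`!)%:R / (n`!)%:R.
Proof.
elim: k => [|k IH]; first by rewrite /pochhammer big_ord0 addn0 divff ?fact_neq0.
rewrite /pochhammer big_ord_recr -/(pochhammer _ _) IH /= addnS factS -natrD natrM addSn.
by rewrite mulrC mulrA.
Qed.

(** The product telescopes over [k]; the product over [j] then gives factorials, and the one over
    [i] superfactorials. *)
Lemma macmahonE x y z : macmahon x y z =
  superfact x * superfact y * superfact z * superfact (x + y + z) /
  (superfact (x + y) * superfact (y + z) * superfact (x + z)).
Proof.
have tele i j : \prod_(1 <= k < z.+1) ((i.+1 + j.+1 + k - 1)%N%:R / (i.+1 + j.+1 + k - 2)%N%:R) =
    (i + j + z).+1%:R / (i + j).+1%:R :> rat.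
  elim: z => [|n IH]; first by rewrite big_geq // addn0 divff ?pnatr_eq0.
  rewrite big_nat_recr //= IH.
  have -> : (i.+1 + j.+1 + n.+1 - 1 = (i + j + n.+1).+1)%N by lia.
  have -> : (i.+1 + j.+1 + n.+1 - 2 = (i + j + n).+1)%N by lia.
  by field; nat_ne0.
have tele2 i : \prod_(1 <= j < y.+1) \prod_(1 <= k < z.+1)
    ((i.+1 + j + k - 1)%N%:R / (i.+1 + j + k - 2)%N%:R) =
    ((y + z + i)`!)%:R * (i`!)%:R / (((y + i)`!)%:R * ((z + i)`!)%:R) :> rat.
  rewrite big_add1 /=; elim: y => [|n IH].
    by rewrite big_nil !add0n; field; nat_ne0.
  rewrite big_nat_recr //= IH tele !addSn !factS !natrM.
  have -> : (i + n + z = n + z + i)%N by lia.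
  have -> : (i + n = n + i)%N by lia.
  by field; nat_ne0.
rewrite /macmahon big_add1 /= big_mkord.
under eq_bigr do rewrite tele2.
rewrite big_split big_split /= prod_fact_shift -/(superfact x) prodfV big_split /=.
rewrite !prod_fact_shift invfM !invf_div [(z + x)%N]addnC [(y + x)%N]addnC.
have -> : (y + z + x = x + y + z)%N by lia.
field; rewrite !superfact_neq0 //.
Qed.

(** * Symmetric sets of end points *)

Lemma mem_mirror o k t i : (k <= o)%N -> all (fun l => k + l < o)%N t ->
  (i \in mirror o k t) =
  if (i < o - k)%N then (o.-1 - k - i)%N \in t
  else if (i < o)%N then true
  else (o + k <= i)%N && ((i - (o + k))%N \in t).
Proof.
move=> ko /allP tlt; rewrite /mirror !mem_cat mem_iota.
have -> : (i \in map (fun l => o.-1 - k - l)%N t) = (i < o - k)%N && ((o.-1 - k - i)%N \in t).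
  apply/mapP/andP => [[l lt ->]|[lt it]]; last by exists (o.-1 - k - i)%N; rewrite //; lia.
  by have := tlt _ lt; split; [lia | rewrite (_ : _ - _ = l)%N //; lia].
have -> : (i \in map (addn (o + k)) t) = (o + k <= i)%N && ((i - (o + k))%N \in t).
  apply/mapP/andP => [[l lt ->]|[lt it]]; last by exists (i - (o + k))%N; rewrite // subnKC.
  by rewrite leq_addr addKn.
rewrite subnK //; case: ltnP => [lt|le] /=.
  by rewrite (_ : (o + k <= i)%N = false) ?orbF //; lia.
by case: ltnP.
Qed.

Lemma mirror_uniq o k t : (k <= o)%N -> all (fun l => k + l < o)%N t -> uniq t ->
  uniq (mirror o k t).
Proof.
move=> ko /allP tlt ut; rewrite /mirror !cat_uniq iota_uniq /=; apply/and4P; split.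
- by rewrite map_inj_in_uniq // => l m /tlt lo /tlt mo; lia.
- apply/hasPn => p; rewrite mem_cat => H; apply/negP => /mapP[l /tlt lo pE]; move: H.
  by rewrite mem_iota => /orP[|/mapP[m _]]; lia.
- by apply/hasPn => p /mapP[m _ ->]; rewrite mem_iota; lia.
- by rewrite map_inj_uniq //; apply: addnI.
Qed.

Section Bijection.
Variables (a b c k : nat).
Let x := (a.*2 + k)%N.
Let y := (b.*2 + k)%N.
Let z := (c.*2 + k)%N.
Let o := (a + c + k)%N.
Let h := (b + c + k)%N.
Let L := minn (a + b) (a + c).

Notation adm := (@admissible x y z k h o).

Lemma reflect_position (i : nat) : (x + z - i.+1 = o + o - i.+1)%N.
Proof. by rewrite /x /z /o; lia. Qed.

(** On the central line the region is symmetric except at the bottom side of the upper lobe,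
    positions [o] to [o + k - 1], whose mirror image is the top side of the lower lobe. *)
Lemma upB_reflect (i : nat) : (i < x + z)%N ->
  up_in_B x y z k h o (x + z - i.+1) h =
  up_in_B x y z k h o i h && ~~ (o - k <= i < o)%N || (o <= i < o + k)%N.
Proof.
rewrite /up_in_B /x /y /z /o /h; lia.
Qed.

Lemma mid_sym_mirror (t : seq nat) (i : nat) : (i < x + z)%N ->
  up_in_B x y z k h o i h && ~~ (if (i < o - k)%N then (o.-1 - k - i)%N \in t
    else if (i < o)%N then true else (o + k <= i)%N && ((i - (o + k))%N \in t)) =
  up_in_B x y z k h o (x + z - i.+1) h && ~~ (if (x + z - i.+1 < o - k)%N then
    (o.-1 - k - (x + z - i.+1))%N \in t
    else if (x + z - i.+1 < o)%N then true else
     (o + k <= x + z - i.+1)%N && ((x + z - i.+1 - (o + k))%N \in t)).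
Proof.
move=> lti; rewrite upB_reflect //.
have xz : (x + z = o + o)%N by rewrite /x /z /o; lia.
rewrite xz in lti *; clearbody o; clear xz.
case: (ltnP i (o - k)) => [lt|le].
  rewrite ifF; last by lia.
  rewrite ifF; last by lia.
  have -> : (o + k <= o + o - i.+1)%N by lia.
  have -> : (o + o - i.+1 - (o + k) = o.-1 - k - i)%N by lia.
  by rewrite (_ : (o <= i)%N = false) ?andbT ?orbF //; lia.
case: (ltnP i o) => [lto|leo].
  by rewrite /= !andbF.
case: (leqP (o + k) i) => [lek|ltk] /=; last first.
  rewrite [in RHS]ifF; last by lia.
  rewrite ifT; last by lia.
  by rewrite andbF andbT /up_in_B leo (_ : (i + h < o + h + k)%N) ?andbF //; lia.
rewrite ifT; last by lia.
have -> : (o.-1 - k - (o + o - i.+1) = i - (o + k))%N by lia.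
by rewrite andbT orbF.
Qed.

Definition mirror_set (B : {set 'I_L}) : {set 'I_(x + z)} :=
  [set i | val i \in mirror o k (map val (enum B))].

Definition unmirror (A : {set 'I_(x + z)}) : {set 'I_L} :=
  [set l | (o + k + val l)%N \in map val (enum A)].

Let ko : (k <= o)%N. Proof. exact: leq_addl. Qed.

Let Blt (B : {set 'I_L}) : all (fun l => k + l < o)%N (map val (enum B)).
Proof.
by apply/allP => _ /mapP[l _ ->] /=; have := ltn_ord l; rewrite /L /o; lia.
Qed.

Lemma mem_val_enum n (A : {set 'I_n}) (i : nat) :
  (i \in map val (enum A)) = [exists j in A, val j == i].
Proof.
apply/mapP/exists_inP => [[j]|[j jA /eqP <-]]; first by rewrite mem_enum => jA ->; exists j.
by exists j; rewrite // mem_enum.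
Qed.

Lemma val_mem_enum n (A : {set 'I_n}) (i : 'I_n) :
  (val i \in map val (enum A)) = (i \in A).
Proof. by rewrite mem_map ?mem_enum //; apply: val_inj. Qed.

Lemma mirror_set_perm (B : {set 'I_L}) :
  perm_eq (map val (enum (mirror_set B))) (mirror o k (map val (enum B))).
Proof.
apply: uniq_perm.
- by rewrite map_inj_uniq ?enum_uniq //; apply: val_inj.
- by apply: mirror_uniq => //; rewrite map_inj_uniq ?enum_uniq //; apply: val_inj.
move=> i; apply/mapP/idP => [[j]|iM]; first by rewrite mem_enum inE => jM ->.
have lti : (i < x + z)%N.
  move: iM; rewrite !mem_cat mem_iota => /or3P[/mapP[_ /mapP[l _ ->] ->]| |/mapP[_ /mapP[l _ ->] ->]].
  - by have := ltn_ord l; rewrite /L /x /z /o /=; lia.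
  - by rewrite /x /z /o; lia.
  - by have := ltn_ord l; rewrite /L /x /z /o /=; lia.
by exists (Ordinal lti); rewrite // mem_enum inE.
Qed.

Lemma mirror_setK (B : {set 'I_L}) : unmirror (mirror_set B) = B.
Proof.
apply/setP => l; rewrite inE (perm_mem (mirror_set_perm B)) mem_mirror //.
rewrite ifF; last by lia.
by rewrite ifF ?leq_addr ?addKn ?val_mem_enum //; lia.
Qed.

Lemma admissible_mirror (B : {set 'I_L}) : adm (mirror_set B) = (#|B| == a).
Proof.
have szB : #|mirror_set B| = (#|B|.*2 + k)%N.
  rewrite cardE -(size_map val) (perm_size (mirror_set_perm B)).
  rewrite /mirror !size_cat !size_map size_iota -(cardE B); lia.
rewrite /admissible szB.
have -> : (#|B|.*2 + k == x)%N = (#|B| == a) by rewrite /x; lia.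
case: (#|B| == a) => //=; apply/andP; split.
  apply/forall_inP => i; rewrite inE !mem_cat mem_iota => H.
  rewrite /up_in_B; move: H (ltn_ord i).
  case/or3P=> [/mapP[_ /mapP[l _ ->] ->]|iH|/mapP[_ /mapP[l _ ->] ->]] _.
  - have : (l < minn (a + b) (a + c))%N := ltn_ord l.
    rewrite /x /y /z /o /h /=; lia.
  - move: iH; rewrite -[val i]/(nat_of_ord i) /x /y /z /o /h; lia.
  - have : (l < minn (a + b) (a + c))%N := ltn_ord l.
    rewrite /x /y /z /o /h /=; lia.
apply/forallP => i; apply/eqP; rewrite !(perm_mem (mirror_set_perm B)) !mem_mirror // /=.
exact: mid_sym_mirror (ltn_ord i).
Qed.

(** The symmetry condition determines [S] from its part right of the block. At positions [o - k] to
    [o - 1] the mirror position is outside the region, so nothing may be left there and [S] contains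
    them; further out, membership in [S] is symmetric. The bound [L] expresses membership in the
    region. *)
Lemma unmirror_mem (S : seq nat) (i : nat) : (i < x + z)%N ->
    (forall j, j \in S -> up_in_B x y z k h o j h) ->
    up_in_B x y z k h o i h && (i \notin S) =
    up_in_B x y z k h o (x + z - i.+1) h && ((x + z - i.+1)%N \notin S) ->
  (if (i < o - k)%N then (o.-1 - k - i < L)%N && ((o + k + (o.-1 - k - i))%N \in S)
   else if (i < o)%N then true
   else [&& (o + k <= i)%N, (i - (o + k) < L)%N & (o + k + (i - (o + k)))%N \in S]) =
  (i \in S).
Proof.
move=> lti AU.
have := AU i; have := AU (x + z - i.+1)%N; rewrite upB_reflect // reflect_position.
case: (ltnP i (o - k)) => [lt|le].
  have <- : up_in_B x y z k h o i h = (o.-1 - k - i < L)%N.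
    by rewrite /up_in_B; move: lti lt; rewrite /L /x /y /z /o /h; lia.
  have -> : (o + k + (o.-1 - k - i) = o + o - i.+1)%N by lia.
  rewrite (_ : (o <= i)%N = false) /= ?orbF ?andbT; last by lia.
  case: (_ \in S); case: (_ \in S); case: (up_in_B _ _ _ _ _ _ _ _) => //=.
    by move=> /(_ isT).
  by move=> _ /(_ isT).
case: (ltnP i o) => [lto|leo].
  have -> : up_in_B x y z k h o i h by rewrite /up_in_B; move: lto le lti; rewrite /x /y /z /o /h; lia.
  by rewrite /= => _ _; case: (i \in S).
case: (leqP (o + k) i) => [lek|ltk] /=.
  have <- : up_in_B x y z k h o i h = (i - (o + k) < L)%N.
    by rewrite /up_in_B; move: lti lek; rewrite /L /x /y /z /o /h; lia.
  by rewrite subnKC // => _; case: (i \in S) => [/(_ isT) ->|]; rewrite ?andbF.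
have -> : up_in_B x y z k h o i h = false.
  by apply/negbTE; rewrite /up_in_B leo (_ : (i + h < o + h + k)%N) ?andbF //; lia.
by move=> _; case: (i \in S) => // /(_ isT).
Qed.

Lemma mirror_unmirror (A : {set 'I_(x + z)}) : adm A -> mirror_set (unmirror A) = A.
Proof.
case/and3P=> _ /forall_inP AB /forallP sym; apply/setP => i.
have memU (l : nat) : (l \in map val (enum (unmirror A))) =
    (l < L)%N && ((o + k + l)%N \in map val (enum A)).
  rewrite mem_val_enum; apply/exists_inP/andP => [[j]|[lL lA]].
    by rewrite inE => jA /eqP <-; split; first exact: ltn_ord.
  by exists (Ordinal lL); rewrite // inE.
have AU j : j \in map val (enum A) -> up_in_B x y z k h o j h.
  by rewrite mem_val_enum => /exists_inP[p pA /eqP <-]; apply: AB.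
rewrite inE mem_mirror // !memU -[in RHS]val_mem_enum.
exact: (unmirror_mem (ltn_ord i) AU (eqP (sym i))).
Qed.
End Bijection.

(** * Assembly of the closed formula *)

Lemma M_odot_B_product a b c k : (0 < b + c + k)%N ->
  (M_odot (B (a.*2 + k) (b.*2 + k) (c.*2 + k) k))%:R =
  (\prod_(i < a.*2 + k) ((b + c + k + i)`!)%:R) *
  (\prod_(i < k) ((i`!)%:R / (((a + c + i)`!)%:R * ((a + b + k + i)`!)%:R))) *
  \prod_(i < a) ((i`!)%:R * ((k + i)`!)%:R * ((b + c + k + i)`!)%:R /
     (((c + i + k)`!)%:R * ((b + i + k)`!)%:R * ((c + i)`!)%:R * ((b + i)`!)%:R *
      ((b + c + k + k + a + i)`!)%:R)) :> rat.
Proof.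
move=> h0.
have xzo : (a.*2 + k + (c.*2 + k) = (a + c + k).*2)%N by lia.
have yzh : (b.*2 + k + (c.*2 + k) = (b + c + k).*2)%N by lia.
rewrite (M_odot_B xzo yzh (leq_addl _ _) h0).
rewrite (reindex_onto (@mirror_set a b c k) (@unmirror a b c k)) /=; last first.
  exact: mirror_unmirror.
rewrite -(@sum_weight_vdm a b c k _ erefl) mulr_sumr; apply: eq_big => B.
  by rewrite mirror_setK eqxx andbT admissible_mirror.
rewrite mirror_setK eqxx andbT admissible_mirror => /eqP cB.
rewrite (@det_mirror a b c k (map val (enum B))).
- rewrite !big_map !big_enum /=; congr (_ * (_ ^+ 2 * _)).
  by apply: eq_bigr => l _; rewrite big_map big_enum_cond.
- exact: sorted_enum_val.
- exact: mirror_set_perm.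
- by rewrite map_inj_uniq ?enum_uniq //; apply: val_inj.
- by rewrite size_map -cardE.
- by apply/allP => _ /mapP[l _ ->]; have := ltn_ord l; rewrite ltn_min.
Qed.

(* Identifies the superfactorials whose arguments agree up to AC. *)
Ltac merge_superfact :=
  repeat match goal with |- context[superfact ?u] =>
    match goal with |- context[superfact ?v] =>
      tryif constr_eq u v then fail else
        (rewrite (_ : superfact u = superfact v); last by congr superfact; lia)
    end end.

(** Each factor on either side is a quotient of superfactorials of sums of [a], [b], [c] and [k];
    once equal arguments are identified, everything cancels. *)
Lemma product_formula a b c k :
  (\prod_(i < a.*2 + k) ((b + c + k + i)`!)%:R) *
  (\prod_(i < k) ((i`!)%:R / (((a + c + i)`!)%:R * ((a + b + k + i)`!)%:R))) *
  \prod_(i < a) ((i`!)%:R * ((k + i)`!)%:R * ((b + c + k + i)`!)%:R /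
     (((c + i + k)`!)%:R * ((b + i + k)`!)%:R * ((c + i)`!)%:R * ((b + i)`!)%:R *
      ((b + c + k + k + a + i)`!)%:R)) =
  macmahon (b + k) c k *
  \prod_(1 <= i < b.+1) (pochhammer (a + i)%N%:R k / pochhammer i%:R k) *
  \prod_(1 <= i < c.+1)
     (pochhammer (a + k + i)%N%:R b / pochhammer (k + i)%N%:R b *
      (pochhammer (a + k + i)%N%:R (b + k) / pochhammer (k + i)%N%:R (b + k))) :> rat.
Proof.
rewrite macmahonE !big_add1 !big_mkord /=.
have -> : \prod_(i < b) (pochhammer (a + i.+1)%N%:R k / pochhammer i.+1%:R k) =
  \prod_(i < b) (((a + k + i)`!)%:R * (i`!)%:R / (((a + i)`!)%:R * ((k + i)`!)%:R)) :> rat.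
  apply: eq_bigr => i _; rewrite addnS !pochhammer_fact addnAC [(i + k)%N]addnC.
  by field; nat_ne0.
have -> : \prod_(i < c) (pochhammer (a + k + i.+1)%N%:R b / pochhammer (k + i.+1)%N%:R b *
      (pochhammer (a + k + i.+1)%N%:R (b + k) / pochhammer (k + i.+1)%N%:R (b + k))) =
  \prod_(i < c) (((a + k + b + i)`!)%:R * ((k + i)`!)%:R * ((a + k + b + k + i)`!)%:R * ((k + i)`!)%:R /
    (((a + k + i)`!)%:R * ((k + b + i)`!)%:R * ((a + k + i)`!)%:R * ((k + b + k + i)`!)%:R)) :> rat.
  apply: eq_bigr => i _; rewrite !addnS !pochhammer_fact.
  have -> : (a + k + i + b = a + k + b + i)%N by lia.
  have -> : (k + i + b = k + b + i)%N by lia.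
  have -> : (a + k + i + (b + k) = a + k + b + k + i)%N by lia.
  have -> : (k + i + (b + k) = k + b + k + i)%N by lia.
  by field; nat_ne0.
have -> : \prod_(i < a) ((i`!)%:R * ((k + i)`!)%:R * ((b + c + k + i)`!)%:R /
     (((c + i + k)`!)%:R * ((b + i + k)`!)%:R * ((c + i)`!)%:R * ((b + i)`!)%:R *
      ((b + c + k + k + a + i)`!)%:R)) =
   \prod_(i < a) ((i`!)%:R * ((k + i)`!)%:R * ((b + c + k + i)`!)%:R /
     (((c + k + i)`!)%:R * ((b + k + i)`!)%:R * ((c + i)`!)%:R * ((b + i)`!)%:R *
      ((b + c + k + k + a + i)`!)%:R)) :> rat.
  by apply: eq_bigr => i _; rewrite [(c + i + k)%N]addnAC [(b + i + k)%N]addnAC.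
rewrite !(big_split, prodfV) /= !prod_fact_shift -!/(superfact _).
merge_superfact.
by field; rewrite !superfact_neq0.
Qed.

Theorem theorem4 (x y z k : nat)
    (hx : odd x = odd k) (hy : odd y = odd k) (hz : odd z = odd k)
    (kx : (k <= x)%N) (ky : (k <= y)%N) (kz : (k <= z)%N) :
  (M_odot (B x y z k))%:R =
    macmahon (y + k)./2 (z - k)./2 k
    * (\prod_(1 <= i < ((y - k)./2).+1)
        (pochhammer ((x - k)./2 + i)%N%:R k / pochhammer i%:R k))
    * (\prod_(1 <= i < ((z - k)./2).+1)
        (pochhammer ((x + k)./2 + i)%N%:R (y - k)./2
           / pochhammer (k + i)%N%:R (y - k)./2
         * (pochhammer ((x + k)./2 + i)%N%:R (y + k)./2
           / pochhammer (k + i)%N%:R (y + k)./2)))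
  :> rat.
Proof.
have half_diff t : odd t = odd k -> (k <= t)%N -> t = ((t - k)./2.*2 + k)%N.
  move=> tk lekt; have := odd_double_half (t - k).
  by rewrite oddB // tk addbb add0n => ->; rewrite subnK.
rewrite (half_diff x) // (half_diff y) // (half_diff z) //.
move: (x - k)./2 (y - k)./2 (z - k)./2 => a b c {half_diff x y z hx hy hz kx ky kz}.
have -> : ((a.*2 + k + k)./2 = a + k)%N by lia.
have -> : ((b.*2 + k + k)./2 = b + k)%N by lia.
rewrite !addnK !doubleK.
(* If [b], [c] and [k] all vanish, the hexagon has height zero and no triangle: the empty tiling is
   the only one, and all products are empty. *)
have [h0|] := ltnP 0 (b + c + k); first by rewrite M_odot_B_product ?product_formula.
rewrite leqn0 !addn_eq0 => /andP[/andP[/eqP-> /eqP->] /eqP->].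
rewrite /macmahon !big_geq // !mulr1 /M_odot.
rewrite (_ : B _ _ _ _ = set0) ?card_tilings0 //.
by apply/setP => -[[i [j lt]] s].
Qed.
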